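(* Let $G$ be a subgroup of Monod's group $H(\mathbf{R})$ whose action on $\mathbf{R}$ is coherent and such that there is a point $x\in\mathbf{R}\cup\{\pm\infty\}$ for which a group of germs at $x$ is metabelian but not abelian, or abelian of rank greater than $1$. Then $G$ does not embed into Thompson's group $F$.
   Context: $\mathrm{Homeo}^+(\mathbf{R})$ is the group of orientation preserving homeomorphisms of $\mathbf{R}$. Actions are right actions, $x\mapsto x\cdot g$. A group action $G<\mathrm{Homeo}^+(\mathbf{R})$ means a subgroup of $\mathrm{Homeo}^+(\mathbf{R})$. Monod's group $H(\mathbf{R})$ is the group of orientation preserving homeomorphisms of $\mathbf{R}$ that are piecewise $PSL_2(\mathbf{R})$ (i.e. piecewise projective transformations, with finitely many pieces), with breakpoints in the set of fixed points of hyperbolic elements of $PSL_2(\mathbf{R})$. Groups of germs. For $x\in\mathbf{R}$, $G_x$ is the subgroup of elements fixing $x$; $G_x^+$ (resp. $G_x^-$) is the subgroup of $g\in G$ fixing pointwise $[x,x+\delta]$ (resp. $[x-\delta,x]$) for some $\delta>0$ depending on $g$. The groups of germs at $x$ are $G_x/G_x^+$ and $G_x/G_x^-$. At $+\infty$ (resp. $-\infty$) the only group of germs is the quotient of $G$ by the subgroup of elements with trivial germ at $+\infty$ (resp. $-\infty$), i.e. fixing each point of some $(r,\infty)$ (resp. $(-\infty,r)$). ''A group of germs at $x$'' means at least one of these groups. The rank of an abelian group $A$ is its torsion-free rank $\dim_{\mathbf{Q}}(A\otimes\mathbf{Q})$. The action $G<\mathrm{Homeo}^+(\mathbf{R})$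 is coherent if: (i) it is minimal, i.e. all orbits are dense in $\mathbf{R}$; (ii) the groups of germs at $+\infty$ and at $-\infty$ are solvable; (iii) there exists an element of $G$ that has trivial germ at $-\infty$ and does not fix any point in some interval $(r,\infty)$; (iv) there exists an element of $G$ that has trivial germ at $+\infty$ and does not fix any point in some interval $(-\infty,s)$. Thompson's group $F$ is the group of orientation preserving piecewise linear homeomorphisms of $[0,1]$ with finitely many breakpoints, all dyadic rationals, and whose derivatives, wherever they exist, are powers of $2$. ''Embeds'' means: there is an injective group homomorphism. *)

(* Defs.v *)
From HB Require Import structures.
From mathcomp Require Import all_boot all_order all_algebra.
From mathcomp Require Import all_classical all_reals all_analysis.

Set Implicit Arguments.
Unset Strict Implicit.
Unset Printing Implicit Defensive.

Import Order.TTheory GRing.Theory Num.Theory.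
Import numFieldNormedType.Exports.

Local Open Scope classical_set_scope.
Local Open Scope ring_scope.

Record homeo (T : topologicalType) := Homeo {
  homeo_fun :> T -> T;
  homeo_inv : T -> T;
  homeo_funK : cancel homeo_fun homeo_inv;
  homeo_invK : cancel homeo_inv homeo_fun;
  homeo_cts : continuous homeo_fun;
  homeo_inv_cts : continuous homeo_inv }.

Section HomeoGroup.
Variable T : topologicalType.
Implicit Types f g h : homeo T.

HB.instance Definition _ := gen_eqMixin (homeo T).
HB.instance Definition _ := gen_choiceMixin (homeo T).

Lemma homeoP f g : f =1 g -> f = g.
Proof.
case: f g => [f f' fK f'K cf cf'] [g g' gK g'K cg cg'] /= /funext efg.
subst g; have efg' : f' = g'.
  by apply/funext => y; rewrite -{1}(g'K y) fK.
by subst g'; congr Homeo; apply: Prop_irrelevance.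
Qed.

Definition homeo1 : homeo T :=
  @Homeo T idfun idfun (fun=> erefl) (fun=> erefl)
    (fun x => @cvg_id _ (nbhs x)) (fun x => @cvg_id _ (nbhs x)).

Definition homeoV f : homeo T :=
  Homeo (@homeo_invK _ f) (@homeo_funK _ f)
    (@homeo_inv_cts _ f) (@homeo_cts _ f).

Lemma comp_cts (u v : T -> T) :
  continuous u -> continuous v -> continuous (v \o u).
Proof. by move=> cu cv x; apply: continuous_comp; [exact: cu|exact: cv]. Qed.

(* Actions are right actions, x . (f * g) = (x . f) . g, so that in the
   product f * g the map f is applied first. *)
Definition homeoM f g : homeo T :=
  Homeo (can_comp (@homeo_funK _ g) (@homeo_funK _ f))
    (can_comp (@homeo_invK _ f) (@homeo_invK _ g))
    (comp_cts (@homeo_cts _ f) (@homeo_cts _ g))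
    (comp_cts (@homeo_inv_cts _ g) (@homeo_inv_cts _ f)).

Lemma homeoMA : associative homeoM. Proof. by move=> f g h; exact: homeoP. Qed.
Lemma homeo1M : left_id homeo1 homeoM. Proof. by move=> f; exact: homeoP. Qed.
Lemma homeoM1 : right_id homeo1 homeoM. Proof. by move=> f; exact: homeoP. Qed.
Lemma homeoVM : left_inverse homeo1 homeoV homeoM.
Proof. by move=> f; apply: homeoP => x /=; exact: homeo_invK. Qed.
Lemma homeoMV : right_inverse homeo1 homeoV homeoM.
Proof. by move=> f; apply: homeoP => x /=; exact: homeo_funK. Qed.

HB.instance Definition _ :=
  isGroup.Build (homeo T) homeoMA homeo1M homeoM1 homeoVM homeoMV.

End HomeoGroup.

Implicit Types gT hT Q : groupType.

Definition is_subgroup gT (G : set gT) :=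
  [/\ G 1%g, (forall g h, G g -> G h -> G (g * h)%g)
    & (forall g, G g -> G (g^-1)%g)].

Definition generated gT (A : set gT) : set gT :=
  \bigcap_(H in [set H | is_subgroup H /\ A `<=` H]) H.

Fixpoint derived Q (n : nat) : set Q :=
  if n is n'.+1 then
    generated [set [~ x, y]%g | x in @derived Q n' & y in @derived Q n']
  else [set: Q].
Arguments derived : clear implicits.

Definition abelian_group Q := forall x y : Q, commute x y.

Definition solvable_group Q := exists n : nat, derived Q n = [set 1%g].

Definition metabelian_group Q :=
  forall x y : Q, derived Q 1 x -> derived Q 1 y -> commute x y.

(* Q is a copy of the quotient group N / K. *)
Definition is_quotient gT (N K : set gT) Q :=
  exists pi : gT -> Q,
    [/\ forall g h, N g -> N h -> pi (g * h)%g = (pi g * pi h)%g,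
        pi @` N = [set: Q]
      & forall g, N g -> (pi g = 1%g <-> K g)].

(* The map a |-> a (x) 1 from the abelian group A to the rational vector space
   A (x)_Z Q, given by its universal property (extension of scalars). *)
Definition is_tensor_rat (A : groupType) (V : lmodType rat) (t : A -> V) :=
  (forall a b : A, t (a * b)%g = t a + t b) /\
  forall (W : lmodType rat) (f : A -> W),
    (forall a b : A, f (a * b)%g = f a + f b) ->
    exists! g : V -> W, linear g /\ (forall a, g (t a) = f a).

Definition dim_gt (n : nat) (V : lmodType rat) :=
  exists e : 'I_n.+1 -> V, forall c : 'I_n.+1 -> rat,
    \sum_(i < n.+1) c i *: e i = 0 -> forall i, c i = 0.

Definition rank_gt (n : nat) (A : groupType) :=
  exists (V : lmodType rat) (t : A -> V), is_tensor_rat t /\ dim_gt n V.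

Definition embeds gT hT (G : set gT) (H : set hT) :=
  exists phi : gT -> hT,
    [/\ phi @` G `<=` H,
        (forall g h, G g -> G h -> phi (g * h)%g = (phi g * phi h)%g)
      & (forall g h, G g -> G h -> phi g = phi h -> g = h)].

Section RealLine.
Variable R : realType.
Implicit Types (G : set (homeo R)) (g : homeo R) (x : R).

(* Elements of PSL_2(R) are represented by matrices of determinant 1. *)
Definition moebius (M : 'M[R]_2) x : R :=
  (M 0 0 * x + M 0 1) / (M 1 0 * x + M 1 1).

Definition moebius_dom (M : 'M[R]_2) x : bool := M 1 0 * x + M 1 1 != 0.

Definition hyperbolic (M : 'M[R]_2) := \det M = 1 /\ 2 < `|\tr M|.

Definition hyperbolic_fixpoint x :=
  exists M : 'M[R]_2, [/\ hyperbolic M, moebius_dom M x & moebius M x = x].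

(* s contains all the breakpoints; J ranges over the intervals avoiding s, so
   that g agrees with one projective map on each component of ~ s. *)
Definition MonodH : set (homeo R) := [set g : homeo R |
  (forall x y, x < y -> g x < g y) /\
  exists s : seq R,
    (forall x, x \in s -> hyperbolic_fixpoint x) /\
    forall J : interval R, (forall x, x \in s -> x \notin J) ->
      exists M : 'M[R]_2, \det M = 1 /\
        forall x, x \in J -> moebius_dom M x /\ g x = moebius M x].

Definition stab G x : set (homeo R) := [set g : homeo R | G g /\ g x = x].

Definition trivial_right_germ x g :=
  exists2 d : R, 0 < d & forall y, x <= y <= x + d -> g y = y.

Definition trivial_left_germ x g :=
  exists2 d : R, 0 < d & forall y, x - d <= y <= x -> g y = y.

Definition trivial_germ_pinfty g := exists r : R, forall y, r < y -> g y = y.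

Definition trivial_germ_ninfty g := exists r : R, forall y, y < r -> g y = y.

Definition germs_pinfty G : groupType -> Prop :=
  is_quotient G [set g : homeo R | G g /\ trivial_germ_pinfty g].

Definition germs_ninfty G : groupType -> Prop :=
  is_quotient G [set g : homeo R | G g /\ trivial_germ_ninfty g].

Definition is_germ_group G (x : \bar R) (Q : groupType) : Prop :=
  match x with
  | r%:E => is_quotient (stab G r) [set g : homeo R | G g /\ trivial_right_germ r g] Q \/
            is_quotient (stab G r) [set g : homeo R | G g /\ trivial_left_germ r g] Q
  | +oo%E => germs_pinfty G Q
  | -oo%E => germs_ninfty G Q
  end.

Definition minimal G := forall x, dense [set g x | g in G].

Definition coherent G :=
  [/\ minimal G,
      (exists Q, germs_pinfty G Q /\ solvable_group Q) /\
      (exists Q, germs_ninfty G Q /\ solvable_group Q),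
      (exists g, [/\ G g, trivial_germ_ninfty g
                   & exists r : R, forall y, r < y -> g y != y])
    & (exists g, [/\ G g, trivial_germ_pinfty g
                   & exists s : R, forall y, y < s -> g y != y])].

Definition dyadic x := exists (z : int) (n : nat), x = z%:~R / 2 ^+ n.

Definition unit_itv : set R := `[0, 1]%classic.

(* The slope 2 ^ k (k a signed integer) is the derivative on each affine piece. *)
Definition ThompsonF : set (homeo unit_itv) := [set f : homeo unit_itv |
  (forall x y : unit_itv, set_val x < set_val y ->
     set_val (f x) < set_val (f y)) /\
  exists s : seq R,
    (forall x, x \in s -> dyadic x) /\
    forall J : interval R, (forall x, x \in s -> x \notin J) ->
      exists (k : int) (b : R), forall x : unit_itv, set_val x \in J ->
        set_val (f x) = 2 ^ k * set_val x + b].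

End RealLine.

Arguments MonodH : clear implicits.
Arguments unit_itv : clear implicits.
Arguments ThompsonF : clear implicits.

(* Main.v *)
From HB Require Import structures.
Require Import Defs.
From mathcomp Require Import all_boot all_order all_algebra.
From mathcomp Require Import all_classical all_reals all_analysis.
From mathcomp Require Import ring lra.
Import Order.TTheory GRing.Theory Num.Theory.
Import numFieldNormedType.Exports.

(** An embedding of G into F gives a second action of G on a line, piecewise linear
    with slopes powers of 2 and supports in a bounded interval. The two actions are
    almost conjugate, which forces every germ group of the first one to be a
    quotient of a group of integers, hence abelian of rank at most 1.

    Coherence first provides many elements with compact support. Elements of the
    two types given by coherence, translated by minimality, expand any interval
    over any other one ([expand]). This excludes nontrivial abelian normal
    subgroups, because an expanded element has conjugates whose supports cross
    ([no_abelian_normal]), so the derived series of G never becomes trivial; as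
    its terms eventually have trivial germs at both ends, the compactly supported
    elements of G do not all commute ([line_noncommuting]). Moreover the
    commutators of the elements supported on one side of x have no common fixed
    point on that side ([below_moves]).

    In a piecewise linear action, if g and h commute with l, then the commutator
    of g and h is trivial on the support of l ([commutator_fixes_support]): g and
    h fix the ends of the components of that support, and a commutator has slope
    1 at a fixed point of both factors. Elements of G supported on both sides of
    a point x commute, so their commutators have disjoint supports in the second
    line. Therefore each point y of the second line that is moved by commutators
    of compactly supported elements determines a cut of the first line, and this
    defines its foot, a continuous equivariant map to the first line
    ([foot_act], [foot_continuous]). On a component C of its domain the foot is
    onto ([foot_surjective]), has no interior extremum since elements supported
    above a level push maxima up ([foot_no_max]), and so is monotone; and C is
    preserved by G, because components cannot accumulate for a piecewise linear
    element ([linked_act]).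

    Finally, let the stabilizer of x act on C. It fixes the end t of the preimage
    of the half-line to the right of x, and the exponent of its slope at t is a
    homomorphism to the integers. An element of slope 1 is trivial near t, hence,
    pushing forward by the foot, it has trivial right germ at x ([germ_slope]).
    Left germs and germs at infinity are treated in the same way, and a quotient
    of a group of integers is abelian of rank at most 1 ([quotient_of_int]). *)

(** * Increasing actions on the line *)

Section Actions.
Local Set Implicit Arguments.
Local Unset Strict Implicit.
Local Open Scope classical_set_scope.
Local Open Scope ring_scope.
Context {R : realType} {gT : groupType}.
Implicit Types (a : gT -> R -> R) (g h : gT) (x y z : R).

Definition is_action a :=
  [/\ forall g h x, a (g * h)%g x = a h (a g x),
      forall x, a 1%g x = x
    & forall g x y, x < y -> a g x < a g y].

(** Reflecting the line exchanges the two ends and the two sides of a point, so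
    that only one half of each symmetric statement has to be proved. *)
Definition flip a g x := - a g (- x).

Lemma flipK a : flip (flip a) = a.
Proof. by apply/funext => g; apply/funext => x; rewrite /flip !opprK. Qed.

Lemma flip_action a : is_action a -> is_action (flip a).
Proof.
case=> aM a1 alt; split=> [g h x|x|g x y xy]; rewrite /flip.
- by rewrite opprK aM.
- by rewrite a1 opprK.
- by rewrite ltrN2; apply: alt; rewrite ltrN2.
Qed.

Section Basics.
Variable a : gT -> R -> R.
Hypothesis act_a : is_action a.

Lemma actM g h x : a (g * h)%g x = a h (a g x).
Proof. by case: act_a. Qed.

Lemma act1 x : a 1%g x = x.
Proof. by case: act_a. Qed.

Lemma actK g x : a g^-1%g (a g x) = x.
Proof. by rewrite -actM mulgV act1. Qed.

Lemma actKV g x : a g (a g^-1%g x) = x.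
Proof. by rewrite -actM mulVg act1. Qed.

Lemma act_mono g : {mono a g : x y / x <= y}.
Proof. by apply: le_mono => x y; case: act_a => _ _; apply. Qed.

Lemma act_smono g : {mono a g : x y / x < y}.
Proof. exact/leW_mono/act_mono. Qed.

Lemma act_ltV g x y : (a g x < y) = (x < a g^-1%g y).
Proof. by rewrite -{1}(actKV g y) act_smono. Qed.

Lemma act_gtV g x y : (x < a g y) = (a g^-1%g x < y).
Proof. by rewrite -{1}(actKV g x) act_smono. Qed.

Lemma actVfix g x : a g x = x -> a g^-1%g x = x.
Proof. by move=> gx; rewrite -{1}gx actK. Qed.

Lemma actJ g h x : a (g ^ h)%g x = a h (a g (a h^-1%g x)).
Proof. by rewrite conjgE !actM. Qed.

Lemma actJfix g h x : a g x = x -> a (g ^ h)%g (a h x) = a h x.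
Proof. by move=> gx; rewrite actJ actK gx. Qed.

Lemma commute_act g h x : commute g h -> a h (a g x) = a g (a h x).
Proof. by rewrite -!actM => ->. Qed.

(** Applied to orbits, this turns a bounded orbit into a fixed point. *)
Lemma act_sup g (E : set R) : E !=set0 -> has_ubound E ->
  (forall x, E x -> E (a g x)) -> (forall x, E x -> E (a g^-1%g x)) ->
  a g (sup E) = sup E.
Proof.
move=> E0 ubE gE gVE.
have le_sup h : (forall x, E x -> E (a h^-1%g x)) -> sup E <= a h (sup E).
  move=> hE; apply: ge_sup => // x Ex.
  by rewrite -[x](actKV h) act_mono; apply: ub_le_sup => //; exact: hE.
apply/eqP; rewrite eq_le le_sup // andbT.
rewrite -[leRHS](actKV g) act_mono; apply: le_sup => x Ex.
by rewrite invgK; exact: gE.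
Qed.

Lemma act_move_nbhs g z : a g z <> z -> exists y1 y2, [/\ y1 < z, z < y2
  & forall y, y1 < y < y2 -> a g y <> y].
Proof.
move=> /eqP; rewrite neq_lt => /orP[lt|gt].
  exists (a g z), (a g^-1%g z); split=> //; first by rewrite -act_ltV.
  move=> y /andP[y1 y2]; apply/eqP; rewrite lt_eqF //.
  case: (leP z y) => [zy|yz]; first by apply: lt_le_trans zy; rewrite act_ltV.
  by apply: lt_trans y1; rewrite act_smono.
exists (a g^-1%g z), (a g z); split=> //; first by rewrite -act_gtV.
move=> y /andP[y1 y2]; apply/eqP; rewrite gt_eqF //.
case: (leP z y) => [zy|yz]; first by apply: lt_le_trans y2 _; rewrite act_mono.
by apply: lt_trans yz _; rewrite act_gtV.
Qed.

(** A bounded orbit of z would have a supremum fixed by h. Some power of h serves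
    as w; what matters later about a power is that it fixes what h fixes. *)
Lemma escape h p z B :
  (forall y, p < y -> a h y <> y) -> p < z ->
  exists w, (forall y, a h y = y -> a w y = y) /\ B < a w z.
Proof.
move=> hmove pz; apply: contrapT => noescape.
pose E := [set a w z | w in [set w | forall y, a h y = y -> a w y = y]].
have E0 : E z by exists 1%g => [y _|]; rewrite act1.
have ubE : has_ubound E.
  exists B => _ [w hw <-]; rewrite leNgt; apply/negP => Bw.
  by apply: noescape; exists w.
have zsup : z <= sup E by apply: ub_le_sup.
apply: (hmove (sup E)); first exact: lt_le_trans zsup.
apply: act_sup => //; first by exists z.
- move=> _ [w hw <-]; exists (w * h)%g; last by rewrite actM.
  by move=> y hy; rewrite actM hw.
- move=> _ [w hw <-]; exists (w * h^-1)%g; last by rewrite actM.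
  by move=> y hy; rewrite actM hw //; exact: actVfix.
Qed.

End Basics.
End Actions.

(** * Coherent dynamics *)

Section Dynamics.
Local Set Implicit Arguments.
Local Unset Strict Implicit.
Local Open Scope classical_set_scope.
Local Open Scope ring_scope.
Context {R : realType} {gT : groupType}.
Implicit Types (a b : gT -> R -> R) (c f g h m : gT) (x y z : R).

Definition faithful a := forall g, (forall x, a g x = x) -> g = 1%g.

Definition minimal_action a :=
  forall x y z, y < z -> exists g, y < a g x /\ a g x < z.

Definition right_mover a f :=
  (exists r, forall y, y < r -> a f y = y) /\
  (exists r, forall y, r < y -> a f y <> y).

(** The dynamical part of coherence, in a form invariant under reflection. *)
Definition coherent_dynamics a :=
  [/\ is_action a, faithful a, minimal_action a,
      exists f, right_mover a f & exists f, right_mover (flip a) f].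

Lemma flip_dynamics a : coherent_dynamics a -> coherent_dynamics (flip a).
Proof.
case=> act_a fa mina fR fL; split; last by rewrite flipK.
- exact: flip_action.
- move=> g gx; apply: fa => x; have := gx (- x); rewrite /flip opprK.
  exact: oppr_inj.
- move=> x y z yz; have [|g [zg gy]] := mina (- x) (- z) (- y).
    by rewrite ltrN2.
  by exists g; rewrite /flip; split; rewrite 1?ltrNr // ltrNl.
- exact: fL.
Qed.

Lemma repeller a x y : coherent_dynamics a -> x < y -> exists f p,
  [/\ x < p, p < y, a f p = p & forall z, p < z -> a f z <> z].
Proof.
move=> [act_a _ mina [f [[r fr] [r' fr']]] _] xy.
pose E := [set z | a f z = z].
have E0 : E !=set0 by exists (r - 1); apply: fr; lra.
have ubE : has_ubound E.
  by exists r' => z Ez; rewrite leNgt; apply/negP => /fr'.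
have fE : a f (sup E) = sup E.
  apply: act_sup => // z Ez; first by rewrite /E /= !Ez.
  by rewrite /E /= (actVfix act_a Ez).
have [g [xg gy]] := mina (sup E) _ _ xy.
exists (f ^ g)%g, (a g (sup E)); split=> //; first exact: actJfix.
move=> z gz fgz; have : sup E < a g^-1%g z by rewrite -act_ltV.
apply/negP; rewrite -leNgt; apply: ub_le_sup => //.
by rewrite /E /= -[RHS](congr1 (a g^-1%g) fgz) actJ // actK.
Qed.

(** An element repelling from a point p between x and y sends y arbitrarily far
    to the right and keeps x below p; an element of the opposite type whose
    first fixed point q lies beyond B but below the image of y then sends the
    image of x arbitrarily far to the left and keeps the image of y above q. *)
Lemma expand a : coherent_dynamics a ->
  forall x y A B, x < y -> exists c, a c x < A /\ B < a c y.
Proof.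
move=> coh x y A B xy; have [act_a _ _ _ _] := coh.
have [f [p [xp py fp fmove]]] := repeller coh xy.
have [w [fw wy]] := escape act_a (Num.max B p) fmove py.
have wx : a w x < p by rewrite -(fw p fp) act_smono.
have yx : - a w y < - Num.max B p by rewrite ltrN2.
have [g [q [yq qB gq gmove]]] := repeller (flip_dynamics coh) yx.
have qx : q < - a w x.
  by apply: lt_trans qB _; rewrite ltrN2 (lt_le_trans wx) // le_max lexx orbT.
have [v [gv vx]] := escape (flip_action act_a) (- A) gmove qx.
exists (w * v)%g; rewrite !(actM act_a).
move: vx; rewrite /flip opprK ltrN2 => ->; split=> //.
have : a v (- q) < a v (a w y) by rewrite act_smono // ltrNl.
apply: lt_trans; have := gv q gq; rewrite /flip => vq.
have -> : a v (- q) = - q by rewrite -{2}vq opprK.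
by rewrite ltrNr (lt_le_trans qB) // lerN2 le_max lexx.
Qed.

(** The common fixed points form a closed invariant set, which is empty or the
    whole line by minimality. *)
Lemma common_fixed a (P : set gT) x : coherent_dynamics a ->
  (forall g h, P g -> P (g ^ h)%g) ->
  (forall g, P g -> a g x = x) -> forall g, P g -> g = 1%g.
Proof.
move=> [act_a fa mina _ _] PJ Px g Pg; apply: fa => z; apply: contrapT => gz.
have [y1 [y2 [y1z zy2 gy]]] := act_move_nbhs act_a gz.
have [h [hy1 hy2]] := mina x _ _ (lt_trans y1z zy2).
apply: (gy (a h x)); first by rewrite hy1.
by rewrite -{2}(Px _ (PJ g h^-1%g Pg)) actJ // actKV // invgK.
Qed.

Lemma left_gap a m x z : is_action a -> x < z -> a m x = x -> a m z <> z ->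
  exists x', [/\ x' < z, a m x' = x' & forall y, x' < y -> y <= z -> a m y <> y].
Proof.
move=> act_a xz mx mz; pose E := [set y | y < z /\ a m y = y].
have ubE : has_ubound E by exists z => y [/ltW].
have E0 : E !=set0 by exists x.
have msup : a m (sup E) = sup E.
  apply: act_sup => // y [yz my]; first by rewrite /E /= !my.
  by rewrite /E /= (actVfix act_a my).
have supz : sup E < z.
  rewrite lt_neqAle ge_sup // ?andbT; last by move=> y [/ltW].
  by apply/eqP => supz; apply: mz; rewrite -supz.
exists (sup E); split=> // y Ey yz my.
have {}yz : y < z by rewrite lt_neqAle yz andbT; apply/eqP => yz'; apply: mz; rewrite -yz'.
by move: Ey; rewrite ltNge => /negP; apply; apply: ub_le_sup.
Qed.

Lemma right_gap a m x z : is_action a -> z < x -> a m x = x -> a m z <> z ->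
  exists x', [/\ z < x', a m x' = x' & forall y, z <= y -> y < x' -> a m y <> y].
Proof.
move=> act_a zx mx mz; have [||||x' [x'z mx' gap]] :=
  @left_gap (flip a) m (- x) (- z).
- exact: flip_action.
- by rewrite ltrN2.
- by rewrite /flip opprK mx.
- by rewrite /flip opprK => /oppr_inj.
exists (- x'); split; first by rewrite ltrNr.
  by move: mx'; rewrite /flip => /(congr1 -%R); rewrite opprK.
move=> y zy yx' my; apply: (gap (- y)); rewrite ?lerN2 1?ltrNr //.
by rewrite /flip opprK my.
Qed.

(** If m and m' commuted, the images of x under the powers of m' would be fixed
    points of m accumulating at y', a point that m moves. *)
Lemma crossing_ncommute a m m' x x' y y' : is_action a ->
  x' < x -> x < y' -> y' < y ->
  a m x = x -> (forall z, x < z -> z < y -> a m z <> z) ->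
  a m' y' = y' -> (forall z, x' < z -> z < y' -> a m' z <> z) ->
  ~ commute m m'.
Proof.
move=> act_a x'x xy' y'y mx mgap my' m'gap mm'.
pose E := [set z | z < y' /\ a m z = z].
have ubE : has_ubound E by exists y' => z [/ltW].
have E0 : E !=set0 by exists x.
have msup : a m (sup E) = sup E.
  apply: act_sup => // z [zy' mz]; first by rewrite /E /= !mz.
  by rewrite /E /= (actVfix act_a mz).
have m'sup : a m' (sup E) = sup E.
  apply: act_sup => // z [zy' mz]; split.
  - by rewrite -my' act_smono.
  - by rewrite -(commute_act act_a _ mm') mz.
  - by rewrite -(actVfix act_a my') act_smono.
  - by rewrite -(commute_act act_a _ (commuteV mm')) mz.
have xsup : x <= sup E by apply: ub_le_sup.
have supy' : sup E <= y' by apply: ge_sup => // z [/ltW].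
move: supy'; rewrite le_eqVlt => /predU1P[supy'|supy']; last first.
  by apply: (m'gap (sup E)) => //; exact: lt_le_trans xsup.
by apply: (mgap y') => //; rewrite -supy'.
Qed.

(** Otherwise the last fixed point of m would be fixed by all of M, as M commutes
    with m. *)
Lemma fixed_unbounded a (M : set gT) m x B : is_action a ->
  (forall m m', M m -> M m' -> commute m m') ->
  (forall z, exists2 m, M m & a m z <> z) ->
  M m -> a m x = x -> exists2 y, B < y & a m y = y.
Proof.
move=> act_a abM Mmove Mm mx; apply: contrapT => bounded.
pose E := [set z | a m z = z].
have ubE : has_ubound E.
  by exists B => z Ez; rewrite leNgt; apply/negP => Bz; apply: bounded; exists z.
have [m' Mm' []] := Mmove (sup E).
apply: act_sup => //; first by exists x.
  by move=> z Ez; rewrite /E /= -(commute_act act_a _ (abM _ _ Mm Mm')) Ez.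
move=> z Ez; rewrite /E /=.
by rewrite -(commute_act act_a _ (commuteV (abM _ _ Mm Mm'))) Ez.
Qed.

Lemma push_up a f y : is_action a -> a f y <> y -> exists2 f', y < a f' y &
  forall z, a f z = z -> a f' z = z.
Proof.
move=> act_a /eqP; rewrite neq_lt => /orP[lt|gt]; last by exists f.
exists f^-1%g; last by move=> z; exact: actVfix.
by rewrite -act_ltV.
Qed.

Lemma push_down a f y : is_action a -> a f y <> y -> exists2 f', a f' y < y &
  forall z, a f z = z -> a f' z = z.
Proof.
move=> act_a /eqP; rewrite neq_lt => /orP[lt|gt]; first by exists f.
exists f^-1%g; last by move=> z; exact: actVfix.
by rewrite -act_gtV.
Qed.

(** If no element of M other than 1 has a fixed point, then the commutator of
    such an m with an element f that is trivial near -oo has fixed points, so f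
    commutes with m; then m fixes the end of the largest half-line on which f is
    trivial, a contradiction. Otherwise some m in M has a bounded component of support; expanding
    it, and moving one of its ends by an element that fixes the other one,
    produces conjugates of m with crossing components, which cannot commute. *)
Lemma no_abelian_normal a (M : set gT) : coherent_dynamics a ->
  is_subgroup M -> (forall m g, M m -> M (m ^ g)%g) ->
  (forall m m', M m -> M m' -> commute m m') -> forall m, M m -> m = 1%g.
Proof.
move=> coh [M1 MM MV] MJ abM m0 Mm0; apply: contrapT => m0n1.
have [act_a fa mina [f [[r1 fr1] [r2 fr2]]] [g [[r3 gr3] [r4 gr4]]]] := coh.
have Mmove z : exists2 m, M m & a m z <> z.
  apply: contrapT => Mz; apply: m0n1.
  apply: (@common_fixed a M z) => // m Mm; apply: contrapT => mz.
  by apply: Mz; exists m.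
have [[m [x [Mm mn1 mx]]]|free] :=
    pselect (exists m x, [/\ M m, m <> 1%g & a m x = x]); last first.
  have m0free x : a m0 x <> x.
    by move=> m0x; apply: free; exists m0, x.
  (* On a neighbourhood of -oo the elements m0 and m0 ^ f agree. *)
  pose k := (m0^-1 * m0 ^ f)%g.
  have Mk : M k by apply: MM; [exact: MV|exact: MJ].
  pose z := Num.min r1 (a m0 r1) - 1.
  have zr1 : z < r1.
    by rewrite ltrBlDr (le_lt_trans (y := r1)) ?ltrDl // ge_min lexx.
  have zm0r1 : z < a m0 r1.
    by rewrite ltrBlDr (le_lt_trans (y := a m0 r1)) ?ltrDl // ge_min lexx orbT.
  have kz : a k z = z.
    rewrite /k (actM act_a) actJ //.
    rewrite (actVfix act_a (fr1 (a m0^-1%g z) _)) -?act_gtV //.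
    by rewrite actKV // fr1.
  have k1 : k = 1%g by apply: contrapT => kn1; apply: free; exists k, z.
  have m0f : commute m0 f.
    by apply/commgP/conjg_fixP; rewrite -[LHS](mulVKg m0) -/k k1 mulg1.
  pose E := [set z | forall y, y < z -> a f y = y].
  apply: (m0free (sup E)); apply: act_sup => //.
  - by exists r1.
  - exists (r2 + 1) => y Ey; rewrite leNgt; apply/negP => r2y.
    by apply: (fr2 (r2 + 1)); [lra|exact: Ey].
  - move=> y Ey u; rewrite act_gtV // => /Ey fu.
    by rewrite -[u](actKV act_a m0) (commute_act act_a _ m0f) fu.
  - move=> y Ey u; rewrite act_gtV // invgK => /Ey fu.
    by rewrite -[u](actK act_a m0) (commute_act act_a _ (commute_sym (commuteV (commute_sym m0f)))) fu.
have [z mz] : exists z, a m z <> z.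
  by apply: contrapT => mfix; apply: mn1; apply: fa => z; apply: contrapT => mz;
    apply: mfix; exists z.
have [y2 zy2 my2] := fixed_unbounded z act_a abM Mmove Mm mx.
have [y1 y1z my1] : exists2 y, y < z & a m y = y.
  have [|||y zy my] := @fixed_unbounded (flip a) M m (- x) (- z) _ abM _ Mm.
  - exact: flip_action.
  - move=> u; have [k Mk ku] := Mmove (- u); exists k => //.
    by rewrite /flip => /(congr1 -%R); rewrite opprK.
  - by rewrite /flip opprK mx.
  exists (- y); first by rewrite ltrNl.
  by move: my; rewrite /flip => /(congr1 -%R); rewrite opprK.
have [al [alz mal lgap]] := left_gap act_a y1z my1 mz.
have [be [zbe mbe rgap]] := right_gap act_a zy2 my2 mz.
have gap y : al < y -> y < be -> a m y <> y.
  by case: (leP y z) => yz aly ybe; [exact: lgap|apply: rgap => //; exact: ltW].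
(* The expanded component starts where f is trivial and g moves points, and ends
   where g is trivial and f moves points. *)
have [c [cal cbe]] :=
  expand coh (Num.min r1 (- r4)) (Num.max r2 (- r3)) (lt_trans alz zbe).
move: cal cbe; rewrite lt_min gt_max => /andP[calr1 calr4] /andP[cber2 cber3].
have gapJ h y : a h al < y -> y < a h be -> a (m ^ h)%g y <> y.
  move=> hy yh; rewrite actJ // => /(congr1 (a h^-1%g)); rewrite actK //.
  by apply: gap; rewrite -?act_ltV // -act_gtV.
have [f' fbe ffix] := push_up act_a (fr2 _ cber2).
have gal : a g (a c al) <> a c al.
  move=> gcal; apply: (gr4 (- a c al)); first by rewrite ltrNr.
  by rewrite /flip opprK gcal.
have [g' g'al gfix] := push_down act_a gal.
have f'al : a f' (a c al) = a c al by apply: ffix; exact: fr1.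
have g'be : a g' (a c be) = a c be.
  apply: gfix; have := gr3 (- a c be); rewrite /flip opprK ltrNl => /(_ cber3).
  exact: oppr_inj.
have cf'al : a (c * f')%g al = a c al by rewrite (actM act_a).
have cg'be : a (c * g')%g be = a c be by rewrite (actM act_a).
apply: (@crossing_ncommute a (m ^ (c * f'))%g (m ^ (c * g'))%g
  (a c al) (a g' (a c al)) (a f' (a c be)) (a c be)) => //.
- by rewrite act_smono // (lt_trans alz zbe).
- by rewrite -cf'al actJfix.
- by move=> y; rewrite -cf'al -(actM act_a c); exact: gapJ.
- by rewrite -cg'be actJfix.
- by move=> y; rewrite -cg'be -(actM act_a c); exact: gapJ.
- by apply: abM; apply: MJ.
Qed.

Definition supp_in a x y g := forall z, a g z <> z -> x < z /\ z < y.

Definition below a y : set gT := [set g | exists x, supp_in a x y g].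

Definition above a x : set gT := [set g | exists y, supp_in a x y g].

Definition cpt_supp a : set gT := [set g | exists x y, supp_in a x y g].

(** The commutators have the same common fixed points as the derived subgroup
    that they generate. *)
Definition comm_fix b (P : set gT) y :=
  forall g h, P g -> P h -> b [~ g, h]%g y = y.

Lemma supp_inJ a x y g c : is_action a ->
  supp_in a x y g -> supp_in a (a c x) (a c y) (g ^ c)%g.
Proof.
move=> act_a gs z; rewrite actJ // => gz.
have [|xz zy] := gs (a c^-1%g z); first by move=> E; apply: gz; rewrite E actKV.
by split; [rewrite act_ltV|rewrite act_gtV].
Qed.

Lemma below_conj a b c x y : is_action a -> is_action b ->
  comm_fix b (below a x) y -> comm_fix b (below a (a c x)) (b c y).
Proof.
move=> act_a act_b fixy g h [lg gs] [lh hs].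
have gx k l : supp_in a l (a c x) k -> below a x (k ^ c^-1)%g.
  by move=> ks; exists (a c^-1%g l); rewrite -[x](actK act_a c); exact: supp_inJ.
rewrite -[[~ g, h]%g](conjgKV c) actJfix // conjRg; apply: fixy; [exact: gx gs|exact: gx hs].
Qed.

Lemma below_sub a x x' : x <= x' -> below a x `<=` below a x'.
Proof.
move=> xx' g [l gs]; exists l => z /gs[lz zx]; split=> //.
exact: lt_le_trans xx'.
Qed.

Lemma comm_fix_sub b (P Q : set gT) y :
  P `<=` Q -> comm_fix b Q y -> comm_fix b P y.
Proof. by move=> PQ Qy g h /PQ Qg /PQ Qh; apply: Qy. Qed.

Lemma below_cpt a x g : below a x g -> cpt_supp a g.
Proof. by case=> l gs; exists l, x. Qed.

Lemma cpt_below a g : cpt_supp a g ->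
  exists x, forall x', x <= x' -> below a x' g.
Proof.
by case=> l [x gs]; exists x => x' xx'; apply: (below_sub xx'); exists l.
Qed.

(** A common fixed point u < x of the commutators can be brought by an expanding
    element into the half-line where some f is trivial while x is brought to
    where f escapes to +oo, so the image of u is fixed by the commutators of all
    compactly supported elements; these are normal, so minimality applies. *)
Lemma below_moves a u x : coherent_dynamics a ->
  (exists g h, [/\ cpt_supp a g, cpt_supp a h & ~ commute g h]) ->
  u < x -> ~ comm_fix a (below a x) u.
Proof.
move=> coh [g [h [cg ch gh]]] ux fixu.
have [act_a _ _ [f [[r1 fr1] [r2 fr2]]] _] := coh.
have [c [cu cx]] := expand coh r1 r2 ux.
have {}fixu := below_conj (c := c) act_a act_a fixu.
have fixcpt : comm_fix a (cpt_supp a) (a c u).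
  move=> k l /cpt_below[xk sk] /cpt_below[xl sl].
  have [w [fw wx]] := escape act_a (Num.max xk xl) fr2 cx.
  move: wx; rewrite gt_max => /andP[kx lx].
  rewrite -[a c u](fw _ (fr1 _ cu)); apply: (below_conj (c := w) act_a act_a fixu).
    exact/sk/ltW.
  exact/sl/ltW.
apply: gh; apply/commgP/eqP.
pose P := [set k | exists g h, [/\ cpt_supp a g, cpt_supp a h & k = [~ g, h]%g]].
apply: (@common_fixed a P (a c u)) => //; last 2 first.
- by move=> _ [k [l [ck cl ->]]]; exact: fixcpt.
- by exists g, h.
move=> _ d [k [l [[x1 [x2 ck]] [x3 [x4 cl]] ->]]]; rewrite conjRg.
exists (k ^ d)%g, (l ^ d)%g; split=> //.
  by exists (a d x1), (a d x2); exact: supp_inJ.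
by exists (a d x3), (a d x4); exact: supp_inJ.
Qed.

End Dynamics.

(** * Piecewise linear actions with slopes powers of 2 *)

Section PiecewiseLinear.
Local Set Implicit Arguments.
Local Unset Strict Implicit.
Local Open Scope classical_set_scope.
Local Open Scope ring_scope.
Context {R : realType} {gT : groupType}.
Implicit Types (a b : gT -> R -> R) (c g h l r : gT) (x y z e : R).

Definition right_dyadic (f : R -> R) e := exists (k : int) (d : R), 0 < d /\
  forall z, e <= z -> z < e + d -> f z = f e + 2 ^ k * (z - e).

(** An abstraction of subgroups of F that is stable under reflection, which
    [0,1] is not. *)
Definition dyadic_action b :=
  [/\ is_action b,
      forall g e, right_dyadic (b g) e,
      forall g e, right_dyadic (flip b g) e
    & exists lo hi, forall g y, y <= lo \/ hi <= y -> b g y = y].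

Lemma flip_dyadic b : dyadic_action b -> dyadic_action (flip b).
Proof.
case=> act_b rb lb [lo [hi bfix]]; split=> //.
- exact: flip_action.
- by rewrite flipK.
- exists (- hi), (- lo) => g y hy; rewrite /flip bfix ?opprK //.
  by case: hy => ?; [right; rewrite lerNr|left; rewrite lerNl].
Qed.

Definition right_slope b g e (k : int) := b g e = e /\
  exists2 d : R, 0 < d & forall z, e <= z -> z < e + d -> b g z = e + 2 ^ k * (z - e).

Section Slopes.
Variable b : gT -> R -> R.
Hypothesis dy_b : dyadic_action b.

Let act_b : is_action b. Proof. by case: dy_b. Qed.

Let pow2_gt0 (k : int) : 0 < 2 ^ k :> R.
Proof. by apply: exprz_gt0; rewrite ltr0n. Qed.

Lemma right_slope_ex g e : b g e = e -> exists k, right_slope b g e k.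
Proof.
move=> ge; have [_ rb _ _] := dy_b; have [k [d [d0 bk]]] := rb g e.
by exists k; split=> //; exists d => // z ez zd; rewrite bk // ge.
Qed.

Lemma right_slopeM g h e k k' : right_slope b g e k -> right_slope b h e k' ->
  right_slope b (g * h)%g e (k + k').
Proof.
move=> [ge [d d0 bg]] [he [d' d'0 bh]]; split; first by rewrite (actM act_b) ge.
have d20 : 0 < d' / 2 ^ k by rewrite divr_gt0.
exists (Num.min d (d' / 2 ^ k)); first by rewrite lt_min d0.
move=> z ez; rewrite -ltrBlDl lt_min => /andP[zd zd'].
rewrite (actM act_b) bg // -?ltrBlDl // bh //.
- by rewrite [e + _ - e]addrAC subrr add0r mulrA -expfzDr ?pnatr_eq0 // (addrC k').
- by rewrite lerDl mulr_ge0 ?subr_ge0 // ltW.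
- by rewrite ltrD2l mulrC -ltr_pdivlMr.
Qed.

Lemma right_slopeV g e k : right_slope b g e k -> right_slope b g^-1%g e (- k).
Proof.
move=> [ge [d d0 bg]]; split; first exact: actVfix.
exists (d * 2 ^ k); first by rewrite mulr_gt0.
move=> z ez; rewrite -ltrBlDl => zd; apply: (can_inj (actK act_b g)).
rewrite actKV // bg.
- by rewrite [e + _ - e]addrAC subrr add0r mulrA -expfzDr ?pnatr_eq0 // subrr expr0z mul1r subrKC.
- by rewrite lerDl mulr_ge0 ?subr_ge0 // ltW.
- by rewrite ltrD2l mulrC -invr_expz ltr_pdivrMr.
Qed.

Lemma right_slope_inj g e k k' :
  right_slope b g e k -> right_slope b g e k' -> k = k'.
Proof.
move=> [_ [d d0 bk]] [_ [d' d'0 bl]].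
pose t := Num.min d d' / 2.
have m0 : 0 < Num.min d d' by rewrite lt_min d0.
have t0 : 0 < t by rewrite divr_gt0.
have tm : t < Num.min d d' by rewrite ltr_pdivrMr // ltr_pMr // ltr1n.
move: tm; rewrite lt_min => /andP[td td'].
have := bl (e + t); rewrite bk ?lerDl ?ltrD2l //; last exact: ltW.
rewrite (ltW t0) td' => /(_ isT isT) /addrI; rewrite (addrC e) addrK.
move=> /(mulIf (lt0r_neq0 t0)); apply: ieexprIz; first by rewrite ltr0n.
by rewrite gt_eqF // ltr1n.
Qed.

Lemma right_slope0 g e : right_slope b g e 0 ->
  exists2 d, 0 < d & forall z, e <= z -> z < e + d -> b g z = z.
Proof.
by move=> [_ [d d0 bg]]; exists d => // z ez zd; rewrite bg // expr0z mul1r subrKC.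
Qed.

Lemma right_slope_comm g h e : b g e = e -> b h e = e ->
  right_slope b [~ g, h]%g e 0.
Proof.
move=> /right_slope_ex[k gk] /right_slope_ex[k' hk'].
have := right_slopeM (right_slopeV gk)
  (right_slopeM (right_slopeV hk') (right_slopeM gk hk')).
by rewrite (addrCA (- k')) addNr addr0 addNr commgEl conjgE.
Qed.

Lemma right_accumulation g e : b g e = e ->
  (forall d, 0 < d -> exists z, [/\ e < z, z < e + d & b g z = z]) ->
  right_slope b g e 0.
Proof.
move=> ge acc; have [k [_ [d d0 bg]]] := right_slope_ex ge.
have [z [ez zd gz]] := acc d d0.
have z0 : 0 < z - e by rewrite subr_gt0.
have : (2 : R) ^ k = 2 ^ 0.
  apply: (mulIf (lt0r_neq0 z0)); rewrite expr0z mul1r; apply: (addrI e).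
  by rewrite -bg ?(ltW ez) // gz subrKC.
move=> k1; split=> //; exists d => // y ey yd; rewrite -k1; exact: bg.
Qed.

End Slopes.

(** An element with a fixed point at every point of an increasing orbit fixes the
    limit of that orbit, where it is affine on the left; hence it is trivial
    there. This is the form in which the finite number of components of the
    support of an element of F is used. *)
Lemma no_accumulation b c h z : dyadic_action b -> z < b h z ->
  (forall n, b c (b (h ^+ n)%g z) = b (h ^+ n)%g z) ->
  exists n, forall y, b (h ^+ n)%g z <= y -> y <= b (h ^+ n.+1)%g z -> b c y = y.
Proof.
move=> dy_b zh cz; have [act_b _ _ [lo [hi bfix]]] := dy_b.
pose E := [set b (h ^+ n)%g z | n in [set: nat]].
have zhi : z <= hi.
  by rewrite leNgt; apply/negP => /ltW hiz; move: zh; rewrite bfix ?ltxx //; right.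
have ubE : has_ubound E.
  exists hi => _ [n _ <-]; rewrite -(bfix (h ^+ n)%g hi) ?act_mono //.
  by right.
have E0 : E !=set0 by exists (b (h ^+ 0)%g z); exists 0%N.
have incr n : b (h ^+ n)%g z < b (h ^+ n.+1)%g z.
  by rewrite expgS (actM act_b) act_smono.
have lesup n : b (h ^+ n)%g z <= sup E by apply: ub_le_sup => //; exists n.
have csup : b c (sup E) = sup E.
  apply: act_sup => // x [n _ <-]; first by exists n; rewrite ?cz.
  by exists n => //; rewrite (actVfix act_b (cz n)).
have [d d0 cid] : exists2 d, 0 < d &
    forall y, sup E - d < y -> y <= sup E -> b c y = y.
  have fl := flip_dyadic dy_b.
  have [||d d0 cd] := right_slope0 (right_accumulation (e := - sup E) (g := c) fl _ _).
  - by rewrite /flip opprK csup.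
  - move=> d d0; have [_ [n _ <-] nd] := sup_adherent d0 (conj E0 ubE).
    exists (- b (h ^+ n)%g z); split; last by rewrite /flip opprK cz.
      by rewrite ltrN2 (lt_le_trans (incr n)).
    by rewrite ltrNl opprD opprK.
  exists d => // y yd ye; have := cd (- y); rewrite /flip opprK lerN2 => /(_ ye).
  by rewrite ltrNl opprD opprK => /(_ yd) /oppr_inj.
have [_ [n _ <-] nd] := sup_adherent d0 (conj E0 ubE).
exists n => y ny yn; apply: cid; first exact: lt_le_trans ny.
by apply: le_trans yn _; exact: lesup.
Qed.

(** Let e be the right end of the component of the support of l that contains y.
    Everything that commutes with l fixes e, because otherwise the images of that
    component would accumulate. So the commutator of g and h has slope 1 on the
    left of e, and commuting with l spreads its triviality over the component. *)
Lemma commutator_fixes_support b l g h y : dyadic_action b ->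
  commute l g -> commute l h -> b l y <> y -> b [~ g, h]%g y = y.
Proof.
move=> dy_b lg lh ly; have [act_b _ _ [lo [hi bfix]]] := dy_b.
have yhi : y < hi by rewrite ltNge; apply/negP => hiy; apply: ly; apply: bfix; right.
have lhi : b l hi = hi by apply: bfix; right.
have [e [ye le gap]] := right_gap act_b yhi lhi ly.
(* If r moved e up, the powers of r would map the interval from y to e to
   disjoint intervals moved by l whose right ends are fixed by l. *)
have efix r : commute l r -> b r e <= e.
  move=> lr; rewrite leNgt; apply/negP => er.
  have lrn n : commute l (r ^+ n)%g by exact: commuteX.
  have [|n] := no_accumulation (c := l) dy_b er.
    by move=> n; rewrite (commute_act act_b _ (commute_sym (lrn n))) le.
  move=> /(_ (b (r ^+ n.+1)%g y)); rewrite act_mono // (ltW ye) => H.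
  have {}H := H _ isT; apply: ly; apply: (can_inj (actK act_b (r ^+ n.+1)%g)).
  rewrite (commute_act act_b _ (lrn n.+1)); apply: H.
  rewrite expgS (actM act_b) act_mono // leNgt; apply/negP => yre.
  apply: (gap (b r^-1%g e)); first by rewrite ltW // -act_ltV.
    by rewrite -act_gtV.
  by rewrite -(commute_act act_b _ (commuteV lr)) le.
have fix_e r : commute l r -> b r e = e.
  move=> lr; apply/eqP; rewrite eq_le efix //= -[leLHS](actKV act_b r) act_mono //.
  by apply: efix; exact: commuteV.
have [d d0 cid] : exists2 d, 0 < d &
    forall z, e - d < z -> z <= e -> b [~ g, h]%g z = z.
  have [||d d0 cd] := right_slope0 (right_slope_comm (e := - e) (g := g) (h := h)
    (flip_dyadic dy_b) _ _); rewrite /flip ?opprK ?fix_e //.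
  exists d => // z zd ze; have := cd (- z); rewrite /flip opprK lerN2 => /(_ ze).
  by rewrite ltrNl opprD opprK => /(_ zd) /oppr_inj.
have lc : commute l [~ g, h]%g.
  by rewrite commgEl conjgE; repeat (apply: commuteM || apply: commuteV).
apply: contrapT => cy; pose E := [set z | z < e /\ b [~ g, h]%g z <> z].
have ubE : has_ubound E by exists e => z [/ltW].
have E0 : E !=set0 by exists y.
have supe : sup E <= e - d.
  apply: ge_sup => // z [ze cz]; rewrite leNgt; apply/negP => dz.
  by apply: cz; apply: cid => //; exact: ltW.
apply: (gap (sup E)).
- exact: ub_le_sup.
- by apply: le_lt_trans supe _; rewrite ltrBlDr ltrDl.
have Einv r : commute l r -> commute r [~ g, h]%g -> forall z, E z -> E (b r z).
  move=> lr rc z [ze cz]; split; first by rewrite -(fix_e _ lr) act_smono.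
  by rewrite (commute_act act_b _ rc) => /(can_inj (actK act_b r)).
apply: act_sup => //; first exact: Einv.
by apply: Einv; [exact: commuteV|exact/commute_sym/commuteV/commute_sym].
Qed.

End PiecewiseLinear.

(** * Locating the points of the second line on the first *)

Section Location.
Local Set Implicit Arguments.
Local Unset Strict Implicit.
Local Open Scope classical_set_scope.
Local Open Scope ring_scope.
Context {R : realType} {gT : groupType}.
Implicit Types (a b : gT -> R -> R) (c g h : gT) (s u v x y z : R).

Lemma supp_in_flip a x y g : supp_in a x y g -> supp_in (flip a) (- y) (- x) g.
Proof.
move=> gs z gz; have [|xz zy] := gs (- z).
  by move=> gz'; apply: gz; rewrite /flip gz' opprK.
by split; [rewrite ltrNl|rewrite ltrNr].
Qed.

Lemma below_flip a x : below (flip a) x = above a (- x).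
Proof.
apply/seteqP; split=> g [y gs]; exists (- y).
  by rewrite -[a]flipK; exact: supp_in_flip.
by rewrite -[x]opprK; exact: supp_in_flip.
Qed.

Lemma above_flip a x : above (flip a) x = below a (- x).
Proof. by rewrite -[x]opprK -below_flip flipK opprK. Qed.

Lemma cpt_supp_flip a : cpt_supp (flip a) = cpt_supp a.
Proof.
apply/seteqP; split=> g [x [y gs]]; exists (- y), (- x).
  by rewrite -[a]flipK; exact: supp_in_flip.
exact: supp_in_flip.
Qed.

(** Noncommuting elements with compact support come from the solvability of the
    germs at the two ends. *)
Definition dyadic_model a b :=
  [/\ coherent_dynamics a,
      exists g h, [/\ cpt_supp a g, cpt_supp a h & ~ commute g h],
      dyadic_action b
    & faithful b].

Lemma flip_model a b : dyadic_model a b -> dyadic_model (flip a) b.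
Proof.
by case=> coh nc dy fb; split; rewrite ?cpt_supp_flip //; exact: flip_dynamics.
Qed.

(** Only commutators are known to have disjoint supports in the second action
    when they have disjoint supports in the first one. *)
Definition moved a b y := ~ comm_fix b (cpt_supp a) y.

Lemma moved_flip a b y : moved (flip a) b y = moved a b y.
Proof. by rewrite /moved cpt_supp_flip. Qed.

(** If y corresponded to s under a conjugacy between the two actions, elements
    supported on one side of s would not move y. *)
Definition over a b y s :=
  (forall x, x < s -> comm_fix b (below a x) y) /\
  (forall x, s < x -> comm_fix b (above a x) y).

Lemma over_flip a b y s : over a b y s -> over (flip a) b y (- s).
Proof.
move=> [lt gt]; split=> x xs; rewrite ?below_flip ?above_flip.
  by apply: gt; rewrite ltrNr.
by apply: lt; rewrite ltrNl.
Qed.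

(** The only point that y can lie over, if y is moved. *)
Definition foot a b y := sup [set x | comm_fix b (below a x) y].

Section Model.
Variables a b : gT -> R -> R.
Hypothesis model : dyadic_model a b.

Let coh : coherent_dynamics a. Proof. by case: model. Qed.
Let act_a : is_action a. Proof. by case: coh. Qed.
Let fa : faithful a. Proof. by case: coh. Qed.
Let dy_b : dyadic_action b. Proof. by case: model. Qed.
Let act_b : is_action b. Proof. by case: dy_b. Qed.

Lemma below_above_commute x g h : below a x g -> above a x h -> commute g h.
Proof.
move=> [x1 gs] [x2 hs].
have fix_out k y z w : supp_in a y z k -> w <= y \/ z <= w -> a k w = w.
  move=> ks wyz; apply: contrapT => /ks[yw wz].
  by case: wyz; rewrite leNgt ?yw ?wz.
have gfix w : x <= w -> a g w = w by move=> xw; apply: (fix_out _ _ _ _ gs); right.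
have hfix w : w <= x -> a h w = w by move=> wx; apply: (fix_out _ _ _ _ hs); left.
suff gh w : a h (a g w) = a g (a h w).
  apply/(can_inj (mulgK (h * g)^-1%g)).
  rewrite mulgV; apply: fa => w.
  by rewrite (actM act_a) (actM act_a g) gh -(actM act_a h) actK.
have [wx|xw] := leP w x.
  by rewrite (hfix w wx) hfix // -(gfix x (lexx x)) act_mono.
rewrite (gfix w (ltW xw)) gfix //.
by rewrite -(hfix x (lexx x)) act_mono // ltW.
Qed.

(** Elements supported below x commute with those supported above x, so a
    commutator of the former that moves y forces all commutators of the latter to
    fix y. *)
Lemma below_or_above x y :
  comm_fix b (below a x) y \/ comm_fix b (above a x) y.
Proof.
have [|nb] := pselect (comm_fix b (below a x) y); [by left|right=> g h ag ah].
apply: contrapT => gh; apply: nb => k l bk bl; apply: contrapT => kl; apply: gh.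
have klx r : above a x r -> commute [~ k, l]%g r.
  move=> ar; apply/commute_sym; rewrite commgEl conjgE.
  have rk := commute_sym (below_above_commute bk ar).
  have rl := commute_sym (below_above_commute bl ar).
  by repeat (apply: commuteM || apply: commuteV).
exact: (commutator_fixes_support dy_b (klx _ ag) (klx _ ah) kl).
Qed.

Lemma cpt_above g : cpt_supp a g ->
  exists x, forall x', x' <= x -> above a x' g.
Proof.
rewrite -cpt_supp_flip => /cpt_below[x gx]; exists (- x) => x' x'x.
by rewrite -[x']opprK -below_flip; apply: gx; rewrite lerNr.
Qed.

Lemma feet_has_sup y : moved a b y ->
  [set x | comm_fix b (below a x) y] !=set0 /\
  has_ubound [set x | comm_fix b (below a x) y].
Proof.
move=> my; split.
  apply: contrapT => /set0P/negP/negPn/eqP E0; apply: my => g h cg ch.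
  have [x gx] := cpt_above cg; have [x' hx'] := cpt_above ch.
  have [bf|af] := below_or_above (Num.min x x') y.
    by have : [set x | comm_fix b (below a x) y] (Num.min x x') by []; rewrite E0.
  by apply: af; [apply: gx|apply: hx']; rewrite ge_min lexx ?orbT.
apply: contrapT => nub; apply: my => g h cg ch.
have [x gx] := cpt_below cg; have [x' hx'] := cpt_below ch.
apply: contrapT => gh; apply: nub; exists (Num.max x x') => z fz.
rewrite leNgt; apply/negP; rewrite gt_max => /andP[xz x'z]; apply: gh.
by apply: fz; [apply: gx|apply: hx']; exact: ltW.
Qed.

Lemma over_foot y : moved a b y -> over a b y (foot a b y).
Proof.
move=> /feet_has_sup hs; split=> x; rewrite /foot => xs.
  have d0 : 0 < sup [set x | comm_fix b (below a x) y] - x by rewrite subr_gt0.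
  have [x' fx'] := sup_adherent d0 hs; rewrite subKr => xx'.
  by apply: comm_fix_sub fx'; apply: below_sub; exact: ltW.
have [fx|//] := below_or_above x y.
by move: xs; rewrite ltNge; case: hs => _ ub; rewrite ub_le_sup.
Qed.

Lemma moved_act g y : moved a b y -> moved a b (b g y).
Proof.
move=> my fgy; apply: my => k l [x [x' ks]] [z [z' ls]].
rewrite -[y](actK act_b g) -[[~ k, l]%g](conjgK g) actJfix // conjRg.
by apply: fgy; [exists (a g x), (a g x')|exists (a g z), (a g z')];
  exact: supp_inJ.
Qed.

Lemma above_pushes x u : x < u ->
  exists g h, [/\ above a x g, above a x h & u < a [~ g, h]%g u].
Proof.
move=> xu; have [coh' nc' _ _] := flip_model model.
have := @below_moves _ _ (flip a) (- u) (- x) coh' nc'; rewrite ltrN2 => /(_ xu).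
rewrite below_flip opprK => nfix; apply: contrapT => npush; apply: nfix => g h ag ah.
rewrite /flip opprK; congr (- _); apply/eqP; rewrite eq_le; apply/andP; split.
  by rewrite leNgt; apply/negP => gh; apply: npush; exists g, h.
rewrite leNgt act_ltV // invgR; apply/negP => gh.
by apply: npush; exists h, g.
Qed.

(** The foot of y is moved by some commutator of the first action supported above
    x1, while y is not, against equivariance. *)
Lemma below_above_moved x1 x2 y : moved a b y -> x1 < x2 ->
  comm_fix b (below a x2) y -> ~ comm_fix b (above a x1) y.
Proof.
move=> my x12 f2 f1; have [F0 ubF] := feet_has_sup my.
have x1s : x1 < foot a b y by apply: lt_le_trans x12 _; exact: ub_le_sup.
have [g [h [ag ah]]] := above_pushes x1s; apply/negP; rewrite -leNgt le_eqVlt.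
have fy := f1 _ _ ag ah; apply/orP; left; apply/eqP.
apply: act_sup => // x /= fx; first by rewrite -fy; exact: below_conj.
by rewrite -(actVfix act_b fy); exact: below_conj.
Qed.

Lemma over_uniq y s s' : moved a b y -> over a b y s -> over a b y s' -> s = s'.
Proof.
move=> my; wlog ss' : s s' / s <= s'.
  by move=> wl ov ov'; case: (leP s s') => [|/ltW] ?; [|symmetry]; exact: wl.
move=> [_ ov] [ov' _]; move: ss'; rewrite le_eqVlt => /predU1P[//|ss'].
have [m1 m2] : s < s + (s' - s) / 3 /\ s + (s' - s) / 3 < s + 2 * (s' - s) / 3.
  by split; lra.
by case: (@below_above_moved _ _ y my m2); [apply: ov'; lra|exact: ov].
Qed.

Lemma foot_over y s : moved a b y -> over a b y s -> foot a b y = s.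
Proof. by move=> my; apply: over_uniq my (over_foot my). Qed.

Lemma foot_act g y : moved a b y -> foot a b (b g y) = a g (foot a b y).
Proof.
move=> my; apply: foot_over; first exact: moved_act.
have [lt gt] := over_foot my; split=> x xs.
  rewrite -[x](actKV act_a g); apply: below_conj => //; apply: lt.
  by rewrite -act_gtV.
rewrite -[x]opprK -below_flip -[- x](actKV (flip_action act_a) g).
apply: below_conj => //; first exact: flip_action.
by rewrite below_flip; apply: gt; rewrite /flip !opprK -act_ltV.
Qed.

Lemma foot_ltW y x : moved a b y -> foot a b y < x -> ~ comm_fix b (below a x) y.
Proof.
move=> my yx fx; have [m1 m2] :
  foot a b y < (foot a b y + x) / 2 /\ (foot a b y + x) / 2 < x by split; lra.
by apply: (below_above_moved my m2 fx); have [_] := over_foot my; apply.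
Qed.

Lemma foot_upper y x : moved a b y -> foot a b y < x ->
  exists y1 y2, [/\ y1 < y, y < y2 & forall z, y1 < z -> z < y2 ->
    moved a b z /\ foot a b z <= x].
Proof.
move=> my yx; have := foot_ltW my yx.
move=> /existsNP[g /existsNP[h /not_implyP[bg /not_implyP[bh gh]]]].
have [y1 [y2 [y1y yy2 ghm]]] := act_move_nbhs act_b gh.
exists y1, y2; split=> // z y1z zy2.
have ghz : b [~ g, h]%g z <> z by apply: ghm; rewrite y1z.
have mz : moved a b z.
  by move=> cz; apply: ghz; exact: cz (below_cpt bg) (below_cpt bh).
split=> //; rewrite leNgt; apply/negP => xz; apply: ghz.
by have [lt _] := over_foot mz; exact: (lt x xz g h bg bh).
Qed.

End Model.
End Location.

(** * A monotone equivariant map onto the first line *)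

Section Lifting.
Local Set Implicit Arguments.
Local Unset Strict Implicit.
Local Open Scope classical_set_scope.
Local Open Scope ring_scope.
Context {R : realType} {gT : groupType}.
Implicit Types (a b : gT -> R -> R) (c g h : gT) (s u v x y z : R).

Lemma foot_flip a b y : dyadic_model a b -> moved a b y ->
  foot (flip a) b y = - foot a b y.
Proof.
move=> model my; apply: (foot_over (flip_model model)); first by rewrite moved_flip.
exact/over_flip/over_foot.
Qed.

Lemma foot_lower a b y x : dyadic_model a b -> moved a b y -> x < foot a b y ->
  exists y1 y2, [/\ y1 < y, y < y2 & forall z, y1 < z -> z < y2 ->
    moved a b z /\ x <= foot a b z].
Proof.
move=> model my xy; have [||y1 [y2 [y1y yy2 up]]] :=
    foot_upper (y := y) (x := - x) (flip_model model).
- by rewrite moved_flip.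
- by rewrite foot_flip // ltrN2.
exists y1, y2; split=> // z y1z zy2; have := up z y1z zy2.
by rewrite moved_flip => -[mz]; rewrite foot_flip // lerN2.
Qed.

Lemma foot_continuous a b y : dyadic_model a b -> moved a b y ->
  {for y, continuous (foot a b)}.
Proof.
move=> model my; apply/cvgrPdist_le => /= e e0.
have [|y1 [y2 [y1y yy2 up]]] := foot_upper (x := foot a b y + e) model my.
  by rewrite ltrDl.
have [|z1 [z2 [z1y yz2 low]]] := foot_lower (x := foot a b y - e) model my.
  by rewrite ltrBlDr ltrDl.
have : \forall z \near y, Num.max y1 z1 < z < Num.min y2 z2.
  have yI : y \in `](Num.max y1 z1), (Num.min y2 z2)[.
    by rewrite in_itv /= gt_max y1y z1y lt_min yy2 yz2.
  by have := near_in_itvoo yI; apply: filterS => z; rewrite in_itv.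
apply: filterS => z; rewrite gt_max lt_min => /andP[/andP[y1z z1z] /andP[zy2 zz2]].
have [_ upz] := up z y1z zy2; have [_ lowz] := low z z1z zz2.
by rewrite ler_norml; apply/andP; split; lra.
Qed.

(** Being in the same component of the open set of moved points. *)
Definition linked a b y y' :=
  forall z, (y <= z /\ z <= y') \/ (y' <= z /\ z <= y) -> moved a b z.

Section Component.
Variables a b : gT -> R -> R.
Hypothesis model : dyadic_model a b.

Let coh : coherent_dynamics a. Proof. by case: model. Qed.
Let act_a : is_action a. Proof. by case: coh. Qed.
Let dy_b : dyadic_action b. Proof. by case: model. Qed.
Let act_b : is_action b. Proof. by case: dy_b. Qed.

Lemma linked_refl y : moved a b y -> linked a b y y.
Proof. by move=> my z [] [yz zy]; rewrite (_ : z = y) //; apply: le_anti; apply/andP. Qed.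

Lemma linked_sym y y' : linked a b y y' -> linked a b y' y.
Proof. by move=> yy' z [] ?; apply: yy'; [right|left]. Qed.

Lemma linked_trans y y' y'' :
  linked a b y y' -> linked a b y' y'' -> linked a b y y''.
Proof.
move=> l1 l2 z [] [z1 z2]; case: (leP z y') => [zy'|/ltW y'z].
- by apply: l1; left.
- by apply: l2; left.
- by apply: l2; right.
- by apply: l1; right.
Qed.

Lemma linked_moved y y' z : linked a b y y' -> y <= z -> z <= y' -> moved a b z.
Proof. by move=> l yz zy'; apply: l; left. Qed.

Lemma linked_l y y' : linked a b y y' -> moved a b y.
Proof. by move=> l; apply: l; case: (leP y y') => ?; [left|right; split=> //; exact: ltW]. Qed.

Lemma linked_r y y' : linked a b y y' -> moved a b y'.
Proof. by move/linked_sym; exact: linked_l. Qed.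

Lemma linked_commutator y g h : cpt_supp a g -> cpt_supp a h -> moved a b y ->
  linked a b y (b [~ g, h]%g y).
Proof.
move=> cg ch my z zin fz; have cz := fz _ _ cg ch.
have : moved a b (b [~ g, h]%g y) by exact: moved_act.
case: zin => -[z1 z2].
  have : b [~ g, h]%g y <= z by rewrite -cz act_mono.
  by move=> z3; rewrite (_ : b _ y = z) //; apply: le_anti; apply/andP.
have : z <= b [~ g, h]%g y by rewrite -[leLHS]cz act_mono.
by move=> z3; rewrite (_ : b _ y = z) //; apply: le_anti; apply/andP.
Qed.

(** A finite supremum of the feet of a component would be invariant under all
    commutators of compactly supported elements, as these preserve components. *)
Lemma foot_unbounded y0 x : moved a b y0 -> exists2 y, linked a b y0 y & x < foot a b y.
Proof.
move=> my0; apply: contrapT => bnd.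
pose E := [set foot a b y | y in linked a b y0].
have E0 : E !=set0 by exists (foot a b y0), y0 => //; exact: linked_refl.
have ubE : has_ubound E.
  exists x => _ [y ly <-]; rewrite leNgt; apply/negP => xy.
  by apply: bnd; exists y.
have inv g h : cpt_supp a g -> cpt_supp a h -> forall s, E s -> E (a [~ g, h]%g s).
  move=> cg ch _ [y ly <-]; have my := linked_r ly.
  exists (b [~ g, h]%g y); last by rewrite foot_act.
  exact: linked_trans ly (linked_commutator cg ch my).
have s1 : sup E - 1 < sup E by lra.
have [g [h [ag ah push]]] := above_pushes model s1.
have cpt k : above a (sup E - 1) k -> cpt_supp a k by case=> w ks; exists (sup E - 1), w.
have := act_sup act_a E0 ubE (inv _ _ (cpt _ ag) (cpt _ ah)).
by rewrite invgR => /(_ (inv _ _ (cpt _ ah) (cpt _ ag))) E1; rewrite E1 ltxx in push.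
Qed.

End Component.

Lemma linked_flip a b y y' : linked (flip a) b y y' = linked a b y y'.
Proof.
rewrite /linked; congr (forall z, _ -> _).
by apply/funext => z; rewrite moved_flip.
Qed.

Section ComponentMap.
Variables a b : gT -> R -> R.
Hypothesis model : dyadic_model a b.

Let coh : coherent_dynamics a. Proof. by case: model. Qed.
Let act_a : is_action a. Proof. by case: coh. Qed.
Let fa : faithful a. Proof. by case: coh. Qed.
Let dy_b : dyadic_action b. Proof. by case: model. Qed.
Let act_b : is_action b. Proof. by case: dy_b. Qed.

Lemma foot_within y1 y2 : linked a b y1 y2 ->
  {within `[y1, y2], continuous (foot a b)}.
Proof.
move=> l; apply: continuous_in_subspaceT => z; rewrite inE /= in_itv /= => /andP[z1 z2].
by apply: foot_continuous => //; apply: (linked_moved l).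
Qed.

Lemma foot_surjective y0 v : moved a b y0 ->
  exists2 y, linked a b y0 y & foot a b y = v.
Proof.
move=> my0; have [y ly vy] := foot_unbounded model v my0.
have [y' ly' y'v] : exists2 y, linked a b y0 y & foot a b y < v.
  have [|y' ly' vy'] := foot_unbounded (flip_model model) (y0 := y0) (- v).
    by rewrite moved_flip.
  rewrite linked_flip in ly'; exists y' => //.
  by move: vy'; rewrite foot_flip ?ltrN2 //; exact: linked_r ly'.
have between w w' : w <= w' -> linked a b y0 w -> linked a b y0 w' ->
    Num.min (foot a b w) (foot a b w') <= v <= Num.max (foot a b w) (foot a b w') ->
    exists2 y, linked a b y0 y & foot a b y = v.
  move=> ww' l l' vww'; have lww' := linked_trans (linked_sym l) l'.
  have [t] := IVT ww' (foot_within lww') vww'.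
  rewrite in_itv /= => /andP[wt tw'] <-; exists t => //.
  apply: linked_trans l _ => z zin; apply: lww'.
  by left; case: zin => -[z1 z2]; split; lra.
case: (leP y y') => [yy'|/ltW y'y].
  by apply: (between _ _ yy') => //; rewrite ge_min le_max (ltW vy) (ltW y'v) orbT.
by apply: (between _ _ y'y) => //; rewrite ge_min le_max (ltW vy) (ltW y'v) orbT.
Qed.

(** At an interior maximum y, the foot of y would be pushed up by a commutator of
    elements supported above the feet of y1 and y3; it fixes y1 and y3, hence it
    maps y into the same interval. *)
Lemma foot_no_max y1 y2 y3 : linked a b y1 y3 -> y1 < y2 -> y2 < y3 ->
  ~ (foot a b y1 < foot a b y2 /\ foot a b y3 < foot a b y2).
Proof.
move=> l y12 y23 [f12 f32].
have [y] := EVT_max (ltW (lt_trans y12 y23)) (foot_within l).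
rewrite in_itv /= => /andP[y1y yy3] ymax.
have f2 : foot a b y2 <= foot a b y.
  by apply: ymax; rewrite in_itv /= !ltW.
pose m := Num.max (foot a b y1) (foot a b y3).
have mf : m < foot a b y by apply: lt_le_trans f2; rewrite gt_max f12.
pose x := (m + foot a b y) / 2.
have [mx xf] : m < x /\ x < foot a b y by rewrite /x; split; lra.
move: mx; rewrite gt_max => /andP[y1x y3x].
have [g [h [ag ah push]]] := above_pushes model xf.
have [_ o1] := over_foot model (linked_l l); have [_ o3] := over_foot model (linked_r l).
have my : moved a b y by exact: linked_moved l y1y yy3.
have: foot a b (b [~ g, h]%g y) <= foot a b y.
  apply: ymax; rewrite in_itv /=.
  by rewrite -{1}(o1 _ y1x _ _ ag ah) -(o3 _ y3x _ _ ag ah) !act_mono // y1y.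
by rewrite foot_act // leNgt push.
Qed.

(** If z were fixed by the commutators, its images under the powers of g would cut
    the line into intervals that contain components, each of which is mapped onto
    the first line. So a commutator moving some v would have components of support
    in infinitely many consecutive intervals. *)
Lemma linked_forward y g z : moved a b y -> y < z -> z < b g y -> moved a b z.
Proof.
move=> my yz zg fz.
have fn n : comm_fix b (cpt_supp a) (b (g ^+ n)%g z).
  by apply: contrapT => /(moved_act model (g := (g ^+ n)^-1%g)); rewrite actK.
case: model => _ [k [l [ck cl kl]]] _ _; apply: kl; apply/commgP/eqP.
have [||n cid] := no_accumulation (c := [~ k, l]%g) (h := g) (z := z) dy_b.
- by apply: lt_trans zg _; rewrite act_smono.
- by move=> n; exact: fn.
have my' : moved a b (b (g ^+ n.+1)%g y) by exact: moved_act.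
have zy' : b (g ^+ n)%g z < b (g ^+ n.+1)%g y by rewrite expgS (actM act_b) act_smono.
have y'z : b (g ^+ n.+1)%g y < b (g ^+ n.+1)%g z by rewrite act_smono.
apply: fa => v; have [w lw <-] := foot_surjective v my'.
rewrite -foot_act //; last exact: linked_r lw.
congr foot; apply: cid; rewrite leNgt; apply/negP => wz.
  by apply: (lw (b (g ^+ n)%g z)); [right; rewrite !ltW|exact: fn].
by apply: (lw (b (g ^+ n.+1)%g z)); [left; rewrite !ltW|exact: fn].
Qed.

Lemma linked_act y g : moved a b y -> linked a b y (b g y).
Proof.
move=> my z zin; have mgy : moved a b (b g y) by exact: moved_act.
case: zin => -[]; rewrite le_eqVlt => /predU1P[<-//|z1];
rewrite le_eqVlt => /predU1P[->//|z2]; first exact: linked_forward z2.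
by apply: (linked_forward (g := g^-1%g) mgy z1); rewrite actK.
Qed.

End ComponentMap.

Lemma foot_no_min a b y1 y2 y3 : dyadic_model a b ->
  linked a b y1 y3 -> y1 < y2 -> y2 < y3 ->
  ~ (foot a b y2 < foot a b y1 /\ foot a b y2 < foot a b y3).
Proof.
move=> model l y12 y23 [f21 f23].
have m2 : moved a b y2 by apply: (linked_moved l); exact: ltW.
apply: (foot_no_max (flip_model model) (y1 := y1) (y3 := y3) _ y12 y23).
  by rewrite linked_flip.
by rewrite (foot_flip model (linked_l l)) (foot_flip model m2)
  (foot_flip model (linked_r l)) !ltrN2.
Qed.

(** Any two points x <= y can be enclosed between points m <= M of C whose images
    are at least as far apart as those of c and d, in the same order. *)
Lemma betweenness_monotone (C : set R) (f : R -> R) (c d : R) :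
  (forall x y z, C x -> C y -> C z -> x < y -> y < z ->
     ~ (f x < f y /\ f z < f y) /\ ~ (f y < f x /\ f y < f z)) ->
  C c -> C d -> c < d -> f c < f d ->
  forall x y, C x -> C y -> x <= y -> f x <= f y.
Proof.
move=> btw Cc Cd cd fcd x y Cx Cy; rewrite le_eqVlt => /predU1P[->//|xy].
have [m [Cm mx fm]] : exists m, [/\ C m, m <= x & m <= c /\ f m <= f c].
  case: (leP c x) => cx; first by exists c.
  exists x; split=> //; split; [exact: ltW|rewrite leNgt; apply/negP => fcx].
  by have [_] := btw _ _ _ Cx Cc Cd cx cd; case.
have [M [CM yM fM]] : exists M, [/\ C M, y <= M & f d <= f M].
  case: (leP y d) => yd; first by exists d.
  exists y; split=> //; rewrite leNgt; apply/negP => fyd.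
  by have [] := btw _ _ _ Cc Cd Cy cd yd; case.
rewrite leNgt; apply/negP => fyx.
have fmM : f m < f M by case: fm; lra.
have fym : f y < f m.
  move: mx; rewrite le_eqVlt => /predU1P[->//|mx].
  rewrite ltNge; apply/negP => fmy; have [+ _] := btw _ _ _ Cm Cx Cy mx xy; apply.
  by split=> //; lra.
have my : m < y by exact: le_lt_trans mx xy.
move: yM; rewrite le_eqVlt => /predU1P[yM|yM].
  by move: fmM; rewrite -yM; lra.
have [_] := btw _ _ _ Cm Cy CM my yM; apply; split=> //; lra.
Qed.

(** What is left of a conjugacy between the actions: p may collapse intervals, and
    C need not be the whole second line. *)
Definition lifts a b (C : set R) (p : R -> R) :=
  [/\ dyadic_action b /\ has_lbound C,
      forall g y, C y -> C (b g y),
      forall g y, C y -> p (b g y) = a g (p y),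
      forall v, exists2 y, C y & p y = v
    & forall y y', C y -> C y' -> y <= y' -> p y <= p y'].

(** On a component the foot is monotone, as it has no interior extremum; if it is
    decreasing, the second line is reflected. *)
Lemma lift_exists a b : dyadic_model a b -> exists b' C p, lifts a b' C p.
Proof.
move=> model; have [coh [k [l [ck cl kl]]] dy fb] := model.
have [y0 my0] : exists y, moved a b y.
  apply: contrapT => nm; apply: kl; apply/commgP/eqP; apply: fb => y.
  by apply: contrapT => kly; apply: nm; exists y => fy; apply: kly; exact: fy.
pose C := linked a b y0.
have Cl y : C y -> linked a b y0 y by [].
have [act_b _ _ [lo [hi bfix]]] := dy.
have Cb y : C y -> lo < y < hi.
  move=> /Cl/linked_r my; rewrite !ltNge -negb_or; apply/negP => out; apply: my.
  by move=> g h _ _; apply: bfix; apply/orP.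
have Cinv g y : C y -> C (b g y).
  move=> /Cl ly; exact: (linked_trans ly (linked_act model (g := g) (linked_r ly))).
have Ceq g y : C y -> foot a b (b g y) = a g (foot a b y).
  by move=> /Cl/linked_r my; exact: foot_act.
have Csurj v : exists2 y, C y & foot a b y = v by exact: foot_surjective.
have btw x y z : C x -> C y -> C z -> x < y -> y < z ->
    ~ (foot a b x < foot a b y /\ foot a b z < foot a b y) /\
    ~ (foot a b y < foot a b x /\ foot a b y < foot a b z).
  move=> Cx Cy Cz xy yz; have lxz := linked_trans (linked_sym (Cl _ Cx)) (Cl _ Cz).
  by split; [exact: foot_no_max|exact: foot_no_min].
have [c Cc fc] := Csurj 0; have [d Cd fd] := Csurj 1.
have [cd|dc] := ltP c d.
  exists b, C, (foot a b); split=> //.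
    by split=> //; exists lo => y /Cb/andP[/ltW].
  by apply: (betweenness_monotone btw Cc Cd cd); rewrite fc fd ltr01.
have {}dc : d < c.
  by rewrite lt_neqAle dc andbT; apply/eqP => dc'; move: fd; rewrite dc' fc; lra.
exists (flip b), [set y | C (- y)], (fun y => foot a b (- y)); split.
- split; first exact: flip_dyadic.
  by exists (- hi) => y /Cb/andP[_ /ltW]; rewrite lerNl.
- by move=> g y Cy; rewrite /flip /= opprK; exact: Cinv.
- by move=> g y Cy; rewrite /flip opprK Ceq.
- by move=> v; have [y Cy <-] := Csurj v; exists (- y); rewrite /= opprK.
- apply: (@betweenness_monotone [set y | C (- y)] _ (- c) (- d)); rewrite /= ?opprK //.
  + move=> x y z Cx Cy Cz; rewrite -(ltrN2 y x) -(ltrN2 z y) => xy yz.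
    by have [btw1 btw2] := btw _ _ _ Cz Cy Cx yz xy; split=> -[? ?];
      [apply: btw1|apply: btw2].
  + by rewrite ltrN2.
  + by rewrite fc fd ltr01.
Qed.

End Lifting.

(** * Germs and slopes *)

Section Germs.
Local Set Implicit Arguments.
Local Unset Strict Implicit.
Local Open Scope classical_set_scope.
Local Open Scope ring_scope.
Context {R : realType} {gT : groupType}.
Implicit Types (a b : gT -> R -> R) (g h : gT) (v x y z : R).

Lemma act_inf a g (E : set R) : is_action a -> E !=set0 -> has_lbound E ->
  (forall x, E x -> E (a g x)) -> (forall x, E x -> E (a g^-1%g x)) ->
  a g (inf E) = inf E.
Proof.
move=> act_a [x Ex] lbE gE gVE.
have := @act_sup R gT (flip a) (flip_action act_a) g (-%R @` E).
rewrite /flip -/(inf E) => fixN; apply: oppr_inj; rewrite [RHS]opprK.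
apply: fixN; first by exists (- x), x.
- exact/has_lb_ubN.
- by move=> _ [y Ey <-]; exists (a g y); rewrite ?opprK //; exact: gE.
- by move=> _ [y Ey <-]; exists (a g^-1%g y); rewrite ?opprK //; exact: gVE.
Qed.

Definition preserves a (A : set R) g := forall z, A (a g z) <-> A z.

(** The half-line A is open to the right of a point, or the whole line for the
    germs at -oo. Let t be the infimum of the part of C that lies over A. An element that
    preserves A fixes t, and its slope on the right of t is a power of 2. If this
    slope is 1, the element fixes the points just above t and so their images,
    which are the points of A near its lower end. *)
Lemma germ_slope a b C p (A : set R) : is_action a -> lifts a b C p ->
  A !=set0 -> (forall x y, A x -> x <= y -> A y) ->
  exists s : gT -> int,
    (forall g h, preserves a A g -> preserves a A h -> s (g * h)%g = s g + s h) /\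
    forall g, preserves a A g -> s g = 0 ->
      exists2 z, A z & forall x, A x -> x <= z -> a g x = x.
Proof.
move=> act_a [[dy_b lbC] Cact peq psurj pmono] [v Av] upA.
have [act_b _ _ _] := dy_b.
pose D := [set y | C y /\ A (p y)].
have D0 : D !=set0 by have [y Cy pv] := psurj v; exists y; rewrite /D /= pv.
have lbD : has_lbound D by case: lbC => l lC; exists l => y [/lC].
have pV g : preserves a A g -> preserves a A g^-1%g.
  by move=> gA z; rewrite -{2}[z](actKV act_a g); split=> /gA.
have DA g y : preserves a A g -> D y -> D (b g y).
  by move=> gA [Cy Ay]; split; [exact: Cact|rewrite peq //; exact/gA].
have fixt g : preserves a A g -> b g (inf D) = inf D.
  by move=> gA; apply: act_inf => // y; apply: DA => //; exact: pV.
have slope g : exists k, preserves a A g -> right_slope b g (inf D) k.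
  have [/fixt gt|] := pselect (preserves a A g); last by exists 0.
  by have [k ?] := right_slope_ex dy_b gt; exists k.
have [s hs] := choice slope; exists s; split.
  move=> g h gA hA; apply: (right_slope_inj (b := b) (g := (g * h)%g) (e := inf D)).
    by apply: hs => z; rewrite (actM act_a); split=> [/hA/gA|/gA/hA].
  by apply: right_slopeM => //; exact: hs.
move=> g gA s0; have := hs g gA; rewrite s0 => /right_slope0[d d0 gid].
have [y [Cy Ay] yd] := inf_adherent d0 (conj D0 lbD).
exists (p y) => // x Ax xy; have [w Cw wx] := psurj x.
have tD u : D u -> inf D <= u by exact: ge_inf.
have [wy|yw] := leP w y.
  rewrite -wx -peq // gid //; first by apply: tD; split; rewrite ?wx.
  exact: le_lt_trans yd.
have -> : x = p y by apply: le_anti; rewrite xy -wx pmono // ltW.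
by rewrite -peq // gid //; exact: tD.
Qed.

End Germs.

(** * Quotients of groups of integers *)

Section Quotients.
Local Set Implicit Arguments.
Local Unset Strict Implicit.
Local Open Scope classical_set_scope.
Local Open Scope ring_scope.

Section Additive.
Variables (gT : groupType) (N : set gT).
Hypothesis subN : is_subgroup N.
Implicit Types (g h : gT).

Definition zpow g (z : int) : gT :=
  match z with Posz n => (g ^+ n)%g | Negz n => (g ^- n.+1)%g end.

Lemma zpow_in g z : N g -> N (zpow g z).
Proof.
have [N1 NM NV] := subN => Ng.
have Nn n : N (g ^+ n)%g.
  by elim: n => [|n IHn]; rewrite ?expg0 // expgS; exact: NM.
by case: z => n /=; [|apply: NV].
Qed.

Section Fun.
Variables (V : zmodType) (F : gT -> V).
Hypothesis FM : forall g h, N g -> N h -> F (g * h)%g = F g + F h.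

Lemma additive1 : F 1%g = 0.
Proof.
have [N1 NM NV] := subN.
by apply: (@addrI _ (F 1%g)); rewrite -FM // mulg1 addr0.
Qed.

Lemma additiveV g : N g -> F g^-1%g = - F g.
Proof.
have [N1 NM NV] := subN => Ng.
by apply: (@addrI _ (F g)); rewrite -FM ?mulgV ?additive1 ?subrr //; exact: NV.
Qed.

Lemma additive_zpow g z : N g -> F (zpow g z) = F g *~ z.
Proof.
have [N1 NM NV] := subN => Ng.
have Fn n : N (g ^+ n)%g /\ F (g ^+ n)%g = F g *+ n.
  elim: n => [|n [Nn IHn]]; first by rewrite expg0 mulr0n additive1.
  by rewrite expgS mulrS FM // IHn; split=> //; exact: NM.
case: z => n /=; first by have [_ ->] := Fn n; rewrite -pmulrn.
by have [Nn Fn1] := Fn n.+1; rewrite additiveV // Fn1 NegzE mulrNz -pmulrn.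
Qed.

Lemma additive_comm g h : N g -> N h -> F [~ g, h]%g = 0.
Proof.
have [N1 NM NV] := subN => Ng Nh.
have NgV := NV _ Ng; have NhV := NV _ Nh; have Ngh := NM _ _ Ng Nh.
rewrite commgEl conjgE !FM ?additiveV //; last exact: NM.
by rewrite (addrCA (- F h)) addNr addr0 addNr.
Qed.

End Fun.

(** Both sides are the values of F at elements on which the integer valued map s
    agrees. *)
Lemma additive_proportional (V : zmodType) (F : gT -> V) (s : gT -> int) g h :
  (forall g h, N g -> N h -> F (g * h)%g = F g + F h) ->
  (forall g h, N g -> N h -> s (g * h)%g = s g + s h) ->
  (forall g, N g -> s g = 0 -> F g = 0) ->
  N g -> N h -> F g *~ s h = F h *~ s g.
Proof.
have [N1 NM NV] := subN => FM sM ker Ng Nh.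
apply/eqP; rewrite -subr_eq0; apply/eqP.
have Ngz := zpow_in (s h) Ng; have Nhz := zpow_in (s g) Nh.
rewrite -(additive_zpow FM) // -(additive_zpow FM (g := h)) //.
rewrite -(additiveV FM) // -FM //; last exact: NV.
apply: ker; first by apply: NM => //; exact: NV.
rewrite sM //; last exact: NV.
by rewrite (additiveV sM) // !(additive_zpow sM) // !mulrzz mulrC subrr.
Qed.

End Additive.

(** By the universal property, a linear map from V is determined by its values on
    the image of t, so V is spanned by that image. *)
Lemma tensor_line (A : groupType) (V : lmodType rat) (t : A -> V) (v0 : V) :
  is_tensor_rat t -> (forall x, exists c : rat, t x = c *: v0) ->
  forall v, exists c : rat, v = c *: v0.
Proof.
move=> [tM univ] tv0; have [v00|v00] := eqVneq v0 0.
  have t0 x : t x = 0 by have [c ->] := tv0 x; rewrite v00 scaler0.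
  have [g [_ uniq]] := univ V t tM.
  have gid : g = id by apply: uniq; split.
  have g0 : g = fun=> 0.
    by apply: uniq; split=> [c u w|x]; rewrite ?t0 // scaler0 addr0.
  by move=> v; exists 0; rewrite scale0r -[LHS]/(id v) -gid g0.
have inj c c' : c *: v0 = c' *: v0 -> c = c'.
  by move=> /eqP; rewrite -subr_eq0 -scalerBl scaler_eq0 (negbTE v00) orbF subr_eq0 => /eqP.
have [f tf] := choice tv0.
have fM x y : f (x * y)%g = f x + f y.
  by apply: inj; rewrite scalerDl -!tf tM.
have [l [[llin lt] _]] := univ (rat^o)%type f fM.
have [g [_ uniq]] := univ V t tM.
have gid : g = id by apply: uniq; split.
have gl : g = fun v => (l v : rat) *: v0.
  apply: uniq; split; last by move=> x; rewrite lt -tf.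
  by move=> c u w; rewrite llin scalerDl scalerA.
by move=> v; exists (l v); rewrite -[LHS]/(id v) -gid gl.
Qed.

Lemma line_dim (V : lmodType rat) (v0 : V) :
  (forall v, exists c : rat, v = c *: v0) -> ~ dim_gt 1 V.
Proof.
move=> line [e free]; have [c0 e0] := line (e ord0); have [c1 e1] := line (e ord_max).
have indep (u w : rat) : u *: e ord0 + w *: e ord_max = 0 -> u = 0 /\ w = 0.
  move=> uw; have := free (fun i => if i == ord0 then u else w).
  rewrite big_ord_recl big_ord1 /= (_ : lift ord0 ord0 = ord_max); last exact/val_inj.
  by move=> /(_ uw) H; split; [have := H ord0|have := H ord_max].
have [|_ /eqP] := indep c1 (- c0).
  by rewrite e0 e1 !scalerA mulNr mulrC scaleNr subrr.
rewrite oppr_eq0 => /eqP c00; have [|/eqP] := indep 1 0.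
  by rewrite e0 c00 !scale0r scaler0 addr0.
by rewrite oner_eq0.
Qed.

Lemma quotient_of_int (gT : groupType) (N K : set gT) (Q : groupType)
    (s : gT -> int) : is_subgroup N -> is_quotient N K Q ->
  (forall g h, N g -> N h -> s (g * h)%g = s g + s h) ->
  (forall g, N g -> s g = 0 -> K g) ->
  abelian_group Q /\ ~ rank_gt 1 Q.
Proof.
move=> subN [pi [piM pionto pik]] sM ker.
have [N1 NM NV] := subN.
have lift q : exists2 g, N g & pi g = q.
  by have : [set: Q] q by []; rewrite -pionto.
have pi1 g : N g -> s g = 0 -> pi g = 1%g.
  by move=> Ng s0; apply/pik => //; exact: ker.
split.
  move=> x y; have [g Ng <-] := lift x; have [h Nh <-] := lift y.
  have NgV := NV _ Ng; have NhV := NV _ Nh.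
  have Nc : N [~ g, h]%g := NM _ _ NgV (NM _ _ NhV (NM _ _ Ng Nh)).
  rewrite /commute -!piM // commgC piM //; last exact: NM.
  by rewrite (pi1 [~ g, h]%g) ?mulg1 // (additive_comm subN sM).
move=> [V [t [tens]]]; have [tM _] := tens.
pose F g := t (pi g).
have FM g h : N g -> N h -> F (g * h)%g = F g + F h.
  by move=> Ng Nh; rewrite /F piM // tM.
have t1 : t 1%g = 0.
  by apply: (@addrI _ (t 1%g)); rewrite -tM mulg1 addr0.
have Fker g : N g -> s g = 0 -> F g = 0 by move=> Ng s0; rewrite /F pi1.
suff [v0 tv0] : exists v0, forall q, exists c : rat, t q = c *: v0.
  exact: line_dim (tensor_line tens tv0).
have [[h [Nh sh]]|triv] := pselect (exists h, N h /\ s h <> 0); last first.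
  exists 0 => q; exists 0; have [g Ng <-] := lift q; rewrite scaler0.
  by apply: Fker => //; apply: contrapT => sg; apply: triv; exists g.
exists (F h) => q; have [g Ng <-] := lift q; exists ((s g)%:~R / (s h)%:~R).
have := additive_proportional subN FM sM Fker Ng Nh.
rewrite -/(F g) -!scaler_int => /(congr1 (fun v => (s h)%:~R^-1 *: v)).
rewrite !scalerA mulVf ?scale1r; last by rewrite intr_eq0; apply/eqP.
by move=> ->; rewrite mulrC.
Qed.

End Quotients.

(** * The derived series *)

Section DerivedSeries.
Local Set Implicit Arguments.
Local Unset Strict Implicit.
Local Open Scope classical_set_scope.

Lemma generated_subgroup (gT : groupType) (A : set gT) : is_subgroup (generated A).
Proof.
split=> [H [[H1 _ _] _]//|g h Ag Ah H HA|g Ag H HA].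
  by have [[_ HM _] _] := HA; apply: HM; [exact: Ag|exact: Ah].
by have [[_ _ HV] _] := HA; apply: HV; exact: Ag.
Qed.

Lemma generated_min (gT : groupType) (A H : set gT) :
  is_subgroup H -> A `<=` H -> generated A `<=` H.
Proof. by move=> sH AH g; apply. Qed.

Lemma sub_generated (gT : groupType) (A : set gT) : A `<=` generated A.
Proof. by move=> g Ag H [_]; apply. Qed.

Lemma derived_subgroup (Q : groupType) n : is_subgroup (derived Q n).
Proof. by case: n => [|n]; [split|exact: generated_subgroup]. Qed.

Lemma derived_step (Q : groupType) n : derived Q n.+1 `<=` derived Q n.
Proof.
have [D1 DM DV] := derived_subgroup Q n.
apply: generated_min => // _ [x Dx [y Dy <-]].
exact: DM (DV _ Dx) (DM _ _ (DV _ Dy) (DM _ _ Dx Dy)).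
Qed.

Lemma derived_le (Q : groupType) m n : (m <= n)%N -> derived Q n `<=` derived Q m.
Proof.
move=> /subnK <-; elim: (n - m)%N => // k IHk.
by rewrite addSn; apply: subset_trans IHk; exact: derived_step.
Qed.

Lemma derived_morph (gT hT : groupType) (f : gT -> hT) n :
  (forall x y, f (x * y)%g = (f x * f y)%g) ->
  forall x, derived gT n x -> derived hT n (f x).
Proof.
move=> fM; have f1 : f 1%g = 1%g by apply: (mulgI (f 1%g)); rewrite -fM !mulg1.
have fV x : f x^-1%g = (f x)^-1%g.
  by apply: (mulgI (f x)); rewrite -fM !mulgV f1.
elim: n => // n IHn; have [D1 DM DV] := derived_subgroup hT n.+1.
apply: (@generated_min gT _ [set x | derived hT n.+1 (f x)]).
  split=> [|x y /= Dx Dy|x /= Dx]; rewrite /= ?f1 ?fM ?fV //; first exact: DM.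
  exact: DV.
move=> _ [x Dx [y Dy <-]] /=; rewrite commgEl conjgE !fM !fV.
apply: sub_generated; exists (f x); first exact: IHn.
by exists (f y); first exact: IHn.
Qed.

Lemma solvable_image (gT Q : groupType) (f : gT -> Q) :
  (forall x y, f (x * y)%g = (f x * f y)%g) -> solvable_group Q ->
  exists n, forall m x, (n <= m)%N -> derived gT m x -> f x = 1%g.
Proof.
move=> fM [n Dn]; exists n => m x nm Dx.
have : derived Q n (f x) by apply: derived_morph => //; exact: derived_le nm _ Dx.
by rewrite Dn.
Qed.

(** Every term of the derived series is normal, so it is not abelian as long as it
    is not trivial, and then the next term is not trivial either. *)
Lemma derived_ncommute (R : realType) (gT : groupType) (a : gT -> R -> R) n :
  coherent_dynamics a ->
  exists g h, [/\ derived gT n g, derived gT n h & ~ commute g h].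
Proof.
move=> coh; have key k : (exists2 g, derived gT k g & g <> 1%g) ->
    exists g h, [/\ derived gT k g, derived gT k h & ~ commute g h].
  move=> [g Dg gn1]; apply: contrapT => abel; apply: gn1.
  apply: (no_abelian_normal coh (derived_subgroup gT k)) Dg.
    move=> m h; apply: (derived_morph (f := fun x => (x ^ h)%g)) => x y.
    exact: conjMg.
  by move=> m m' Dm Dm'; apply: contrapT => mm'; apply: abel; exists m, m'.
apply: (key n); elim: n => [|n /key[g [h [Dg Dh gh]]]]; last first.
  exists [~ g, h]%g; last by move=> gh1; apply: gh; apply/commgP/eqP.
  by apply: sub_generated; exists g => //; exists h.
have [act_a _ _ [f [_ [r fr]]] _] := coh.
exists f => // f1; apply: (fr (r + 1)%R); last by rewrite f1 act1.
by rewrite ltrDl ltr01.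
Qed.

End DerivedSeries.

(** * Thompson's group F on the line *)

Section Thompson.
Local Set Implicit Arguments.
Local Unset Strict Implicit.
Local Open Scope classical_set_scope.
Local Open Scope ring_scope.
Context {R : realType}.
Implicit Types (f : homeo (unit_itv R)) (u v : unit_itv R) (x y z e : R).

(** On the whole line, the two actions to be compared are of the same kind. *)
Definition extend f y : R := if insub y is Some u then set_val (f u) else y.

Lemma extend_val f u : extend f (set_val u) = set_val (f u).
Proof. by rewrite /extend valK. Qed.

Lemma unit_val y : 0 <= y <= 1 -> exists u : unit_itv R, set_val u = y.
Proof.
move=> y01; have yI : y \in unit_itv R by rewrite inE /unit_itv /= in_itv.
by exists (SigSub yI).
Qed.

Lemma val_unit u : 0 <= (set_val u : R) <= 1.
Proof. by have := set_valP u; rewrite /unit_itv /= in_itv. Qed.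

Lemma extend_out f y : ~~ (0 <= y <= 1) -> extend f y = y.
Proof.
move=> yN; rewrite /extend insubN //; apply: contra yN.
by rewrite inE /unit_itv /= in_itv.
Qed.

Lemma extendM f (f' : homeo (unit_itv R)) y : extend (f * f')%g y = extend f' (extend f y).
Proof.
have [/unit_val[u <-]|yN] := boolP (0 <= y <= 1); first by rewrite !extend_val.
by rewrite !extend_out.
Qed.

Lemma extend1 y : extend 1%g y = y.
Proof.
have [/unit_val[u <-]|yN] := boolP (0 <= y <= 1); first by rewrite extend_val.
by rewrite extend_out.
Qed.

Lemma extend_inj f (f' : homeo (unit_itv R)) : extend f =1 extend f' -> f = f'.
Proof.
move=> ff'; apply: homeoP => u; have := ff' (set_val u); rewrite !extend_val.
exact: val_inj.
Qed.

Lemma extend_lt f x y : ThompsonF R f -> x < y -> extend f x < extend f y.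
Proof.
move=> [flt _].
have [/unit_val[u <-]|xN] := boolP (0 <= x <= 1);
  have [/unit_val[v <-]|yN] := boolP (0 <= y <= 1) => xy.
- by rewrite !extend_val; exact: flt.
- rewrite extend_val (extend_out _ yN).
  have := val_unit u; have := val_unit (f u); move: yN.
  by rewrite negb_and -!ltNge => /orP[] ? /andP[? ?] /andP[? ?]; lra.
- rewrite extend_val (extend_out _ xN).
  have := val_unit v; have := val_unit (f v); move: xN.
  by rewrite negb_and -!ltNge => /orP[] ? /andP[? ?] /andP[? ?]; lra.
- by rewrite !extend_out.
Qed.

Lemma seq_gap (s : seq R) e : exists2 d, 0 < d &
  forall x, x \in s -> ~ (e < x < e + d).
Proof.
elim: s => [|x s [d d0 gap]]; first by exists 1.
have [ex|xe] := ltP e x; last first.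
  exists d => // y; rewrite inE => /predU1P[->|/gap//].
  by rewrite ltNge xe.
exists (Num.min d (x - e)); first by rewrite lt_min d0 subr_gt0.
move=> y; rewrite inE -ltrBlDl lt_min => /predU1P[->|ys].
  by rewrite ltxx !andbF.
by move=> /and3P[ey yd _]; apply: (gap y ys); rewrite ey -ltrBlDl.
Qed.

Lemma affine_right f e : ThompsonF R f -> exists (k : int) (c d : R), 0 < d /\
  forall z, e < z -> z < e + d -> extend f z = 2 ^ k * z + c.
Proof.
move=> [_ [s [_ affine]]]; have [e0|e0] := ltP e 0.
  exists 0, 0, (- e); split; first by rewrite oppr_gt0.
  move=> z _; rewrite subrr => z0; rewrite expr0z mul1r addr0 extend_out //.
  by rewrite negb_and -ltNge z0.
have [e1|e1] := ltP e 1; last first.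
  exists 0, 0, 1; split=> // z ez _; rewrite expr0z mul1r addr0 extend_out //.
  by rewrite negb_and orbC -ltNge (le_lt_trans e1).
have [d d0 gap] := seq_gap s e.
have [|k [c kc]] := affine `]e, (e + d)[.
  by move=> x /gap/negP; rewrite in_itv.
exists k, c, (Num.min d (1 - e)); split; first by rewrite lt_min d0 subr_gt0.
move=> z ez; rewrite -ltrBlDl lt_min => /andP[zd z1].
have /unit_val[u uz] : 0 <= z <= 1 by apply/andP; split; lra.
by rewrite -uz extend_val kc // uz in_itv /= ez -ltrBlDl.
Qed.

Lemma affine_left f e : ThompsonF R f -> exists (k : int) (c d : R), 0 < d /\
  forall z, z < e -> e - d < z -> extend f z = 2 ^ k * z + c.
Proof.
move=> [_ [s [_ affine]]]; have [e1|e1] := ltP 1 e.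
  exists 0, 0, (e - 1); split; first by rewrite subr_gt0.
  move=> z _; rewrite subKr => z1; rewrite expr0z mul1r addr0 extend_out //.
  by rewrite negb_and orbC -ltNge z1.
have [e0|e0] := ltP 0 e; last first.
  exists 0, 0, 1; split=> // z ez _; rewrite expr0z mul1r addr0 extend_out //.
  by rewrite negb_and -ltNge (lt_le_trans ez).
have [d d0 gap] := seq_gap [seq - x | x <- s] (- e).
have [|k [c kc]] := affine `](e - d), e[.
  move=> x xs; rewrite in_itv /=; apply/negP => /andP[dx xe].
  by apply: (gap (- x)); [exact: map_f|apply/andP; split; lra].
exists k, c, (Num.min d e); split; first by rewrite lt_min d0.
move=> z ze; rewrite ltrBlDl -ltrBlDr lt_min => /andP[zd z0].
have /unit_val[u uz] : 0 <= z <= 1 by apply/andP; split; lra.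
by rewrite -uz extend_val kc // uz in_itv /= ze andbT; lra.
Qed.

(** An increasing bijection has no jump at e, so the affine formula extends to e. *)
Lemma monotone_right_dyadic (f f' : R -> R) e (k : int) (c d : R) :
  {mono f : x y / x < y} -> cancel f' f -> 0 < d ->
  (forall z, e < z -> z < e + d -> f z = 2 ^ k * z + c) -> right_dyadic f e.
Proof.
move=> fmono fK d0 aff; exists k, d; split=> //.
have k0 : 0 < 2 ^ k :> R by apply: exprz_gt0.
suff fe : f e = 2 ^ k * e + c.
  move=> z; rewrite le_eqVlt => /predU1P[->|ez] zd; first by rewrite subrr mulr0 addr0.
  by rewrite fe aff // mulrBr; lra.
apply/eqP; rewrite eq_le; apply/andP; split; rewrite leNgt; apply/negP => lt.
  pose z := e + Num.min (d / 2) ((f e - (2 ^ k * e + c)) / 2 ^ k).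
  have m0 : 0 < Num.min (d / 2) ((f e - (2 ^ k * e + c)) / 2 ^ k).
    by rewrite lt_min !divr_gt0 // subr_gt0.
  have ez : e < z by rewrite ltrDl.
  have zd : z < e + d.
    by rewrite ltrD2l gt_min ltr_pdivrMr // ltr_pMr // ltr1n.
  have : f e < f z by rewrite fmono.
  rewrite (aff z) // ltNge => /negP; apply.
  have : z - e <= (f e - (2 ^ k * e + c)) / 2 ^ k.
    by rewrite /z (addrC e) addrK ge_min lexx orbT.
  rewrite ler_pdivlMr //; lra.
pose w := f' ((f e + (2 ^ k * e + c)) / 2).
have fw : f w = (f e + (2 ^ k * e + c)) / 2 by rewrite /w fK.
have ew : e < w by rewrite -fmono fw; lra.
pose z := e + Num.min (d / 2) ((w - e) / 2).
have m0 : 0 < Num.min (d / 2) ((w - e) / 2).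
  by rewrite lt_min !divr_gt0 // subr_gt0.
have ez : e < z by rewrite ltrDl.
have zd : z < e + d.
  by rewrite ltrD2l gt_min ltr_pdivrMr // ltr_pMr // ltr1n.
have : z < w.
  rewrite -ltrBrDl gt_min; apply/orP; right; lra.
rewrite -fmono fw (aff z) //; have : 2 ^ k * e < 2 ^ k * z by rewrite ltr_pM2l.
lra.
Qed.

Lemma thompson_dyadic (gT : groupType) (phi : gT -> homeo (unit_itv R)) :
  (forall g h, phi (g * h)%g = (phi g * phi h)%g) ->
  (forall g, ThompsonF R (phi g)) -> injective phi ->
  dyadic_action (fun g => extend (phi g)) /\ faithful (fun g => extend (phi g)).
Proof.
move=> phiM phiF phi_inj; have phi1 : phi 1%g = 1%g.
  by apply: (mulgI (phi 1%g)); rewrite -phiM !mulg1.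
have act_b : is_action (fun g => extend (phi g)).
  split=> [g h x|x|g x y]; first by rewrite phiM extendM.
    by rewrite phi1 extend1.
  exact/extend_lt/phiF.
split; last first.
  move=> g gid; apply: phi_inj; apply: extend_inj => y.
  by rewrite gid phi1 extend1.
split=> //.
- move=> g e; have [k [c [d [d0 aff]]]] := affine_right e (phiF g).
  exact: (monotone_right_dyadic (act_smono act_b g) (actKV act_b g) d0 aff).
- move=> g e; have act_fb := flip_action act_b.
  have [k [c [d [d0 aff]]]] := affine_left (- e) (phiF g).
  apply: (monotone_right_dyadic (act_smono act_fb g) (actKV act_fb g)
    (k := k) (c := - c) d0) => z ez zd.
  by rewrite /flip aff; [rewrite mulrN opprD opprK|rewrite ltrN2|lra].
- exists (- 1), 2 => g y [y1|y2]; rewrite extend_out // negb_and -!ltNge.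
    by apply/orP; left; lra.
  by apply/orP; right; lra.
Qed.

End Thompson.

(** * Subgroups as groups *)

Section Subgroups.
Local Set Implicit Arguments.
Local Unset Strict Implicit.
Local Open Scope classical_set_scope.
Variables (gT : groupType) (G : set gT) (sG : is_subgroup G).

(** As a type, G has total actions and its membership proofs stay hidden. *)
Definition subgroup_type of is_subgroup G := {g : gT | `[< G g >]}.
Local Notation sub := (subgroup_type sG).

HB.instance Definition _ := Choice.copy sub {g : gT | `[< G g >]}.

Definition subgroup_val (g : sub) : gT := sval g.

Lemma subgroup_valP g : G (subgroup_val g).
Proof. exact/asboolP/(svalP g). Qed.

Definition subgroup_sub (g : gT) (Gg : G g) : sub := exist _ g (asboolT Gg).

Lemma subgroup_val_inj : injective subgroup_val.
Proof. exact: val_inj. Qed.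

Definition subgroup_one : sub :=
  subgroup_sub (let: And3 G1 _ _ := sG in G1).
Definition subgroup_mul (g h : sub) : sub :=
  subgroup_sub (let: And3 _ GM _ := sG in GM _ _ (subgroup_valP g) (subgroup_valP h)).
Definition subgroup_inv (g : sub) : sub :=
  subgroup_sub (let: And3 _ _ GV := sG in GV _ (subgroup_valP g)).

Lemma subgroup_mulA : associative subgroup_mul.
Proof. by move=> f g h; apply: subgroup_val_inj; exact: mulgA. Qed.
Lemma subgroup_mul1 : left_id subgroup_one subgroup_mul.
Proof. by move=> f; apply: subgroup_val_inj; exact: mul1g. Qed.
Lemma subgroup_mulr1 : right_id subgroup_one subgroup_mul.
Proof. by move=> f; apply: subgroup_val_inj; exact: mulg1. Qed.
Lemma subgroup_mulV : left_inverse subgroup_one subgroup_inv subgroup_mul.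
Proof. by move=> f; apply: subgroup_val_inj; exact: mulVg. Qed.
Lemma subgroup_mulrV : right_inverse subgroup_one subgroup_inv subgroup_mul.
Proof. by move=> f; apply: subgroup_val_inj; exact: mulgV. Qed.

HB.instance Definition _ := isGroup.Build sub
  subgroup_mulA subgroup_mul1 subgroup_mulr1 subgroup_mulV subgroup_mulrV.

End Subgroups.

(** * The germ groups of a coherent group that embeds into F *)

Section Main.
Local Set Implicit Arguments.
Local Unset Strict Implicit.
Local Open Scope classical_set_scope.
Local Open Scope ring_scope.
Context {R : realType}.
Variables (G : set (homeo R)) (sG : is_subgroup G).
Hypothesis G_incr : forall g, G g -> forall x y, x < y -> g x < g y.
Local Notation sub := (subgroup_type sG).

Definition line_action (g : sub) (x : R) : R := (subgroup_val g : homeo R) x.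

Lemma line_action_action : is_action line_action.
Proof. by split=> // g x y; apply: G_incr; exact: subgroup_valP. Qed.

Lemma line_dynamics : coherent G -> coherent_dynamics line_action.
Proof.
move=> [min _ [f [Gf [r1 fr1] [r2 fr2]]] [g [Gg [r3 gr3] [r4 gr4]]]].
split; first exact: line_action_action.
- by move=> h hx; apply: subgroup_val_inj; apply: homeoP => x; exact: hx.
- move=> x y z yz; have [||w [yhz [h Gh hx]]] := min x `]y, z[%classic.
  + by exists ((y + z) / 2); rewrite /= in_itv /=; apply/andP; split; lra.
  + exact: interval_open.
  exists (subgroup_sub sG Gh).
  by move: yhz; rewrite -hx /= in_itv /= => /andP.
- exists (subgroup_sub sG Gf); split; first by exists r1.
  by exists r2 => y /fr2/eqP.
- exists (subgroup_sub sG Gg); rewrite /right_mover /flip /line_action /=.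
  split; first by exists (- r3) => y y3; rewrite gr3 ?opprK // ltrNr.
  exists (- r4) => y y4; rewrite -[RHS]opprK => /oppr_inj; apply/eqP/gr4.
  by rewrite ltrNl.
Qed.

(** A deep term of the derived series dies in both solvable groups of germs at
    infinity, so its elements have compact support. *)
Lemma line_noncommuting : coherent G -> exists g h,
  [/\ cpt_supp line_action g, cpt_supp line_action h & ~ commute g h].
Proof.
move=> cohG; have coh := line_dynamics cohG.
case: cohG => _ [[Q1 [[pi1 [pi1M _ pi1K]] sol1]] [Q2 [[pi2 [pi2M _ pi2K]] sol2]]] _ _.
have [|n1 hn1] := solvable_image (f := fun g : sub => pi1 (subgroup_val g)) _ sol1.
  by move=> g h; apply: pi1M; exact: subgroup_valP.
have [|n2 hn2] := solvable_image (f := fun g : sub => pi2 (subgroup_val g)) _ sol2.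
  by move=> g h; apply: pi2M; exact: subgroup_valP.
have [g [h [Dg Dh gh]]] := derived_ncommute (maxn n1 n2) coh.
have cpt k : derived sub (maxn n1 n2) k -> cpt_supp line_action k.
  move=> Dk; have Gk := subgroup_valP k.
  have [_ [r2 kr2]] := (pi1K _ Gk).1 (hn1 _ _ (leq_maxl _ _) Dk).
  have [_ [r1 kr1]] := (pi2K _ Gk).1 (hn2 _ _ (leq_maxr _ _) Dk).
  exists (r1 - 1), (r2 + 1) => z kz; split; rewrite ltNge; apply/negP => zr; apply: kz.
    by apply: kr1; lra.
  by apply: kr2; lra.
by exists g, h; split=> //; exact: cpt.
Qed.

(** The germ group is a quotient of a group of integers through the slopes
    provided by a lift of the action a, which is the given action or its flip. *)
Lemma germ_group_of_lift (a : sub -> R -> R) b C p (A : set R) (N K : set (homeo R))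
    (Q : groupType) :
  is_action a -> lifts a b C p ->
  A !=set0 -> (forall x y, A x -> x <= y -> A y) ->
  is_subgroup N -> N `<=` G ->
  (forall g, N (subgroup_val g) -> preserves a A g) ->
  (forall g z, N (subgroup_val g) -> A z ->
     (forall x, A x -> x <= z -> a g x = x) -> K (subgroup_val g)) ->
  is_quotient N K Q -> abelian_group Q /\ ~ rank_gt 1 Q.
Proof.
move=> act_a lift A0 upA subN NG NA KA quot.
have [s [sM s0]] := germ_slope act_a lift A0 upA.
have [N1 NM NV] := subN.
pose lf (g : homeo R) : sub :=
  if pselect (G g) is left Gg then subgroup_sub sG Gg else 1%g.
have lfK g : N g -> subgroup_val (lf g) = g.
  by move=> /NG Gg; rewrite /lf; case: pselect.
have lfM g h : N g -> N h -> lf (g * h)%g = (lf g * lf h)%g.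
  move=> Ng Nh; apply: subgroup_val_inj.
  by rewrite lfK ?[RHS](congr2 *%g (lfK _ Ng) (lfK _ Nh)) //; exact: NM.
apply: (quotient_of_int (s := s \o lf) subN quot) => [g h Ng Nh|g Ng].
  by rewrite /= lfM // sM //; apply: NA; rewrite lfK.
move=> /= /s0 [|z Az gz]; first by apply: NA; rewrite lfK.
by rewrite -(lfK g Ng); apply: (KA _ z) => //; rewrite lfK.
Qed.

Lemma stab_subgroup x : is_subgroup (stab G x).
Proof.
have [G1 GM GV] := sG; split; first by split.
  by move=> g h [Gg gx] [Gh hx]; split; [exact: GM|rewrite /= gx].
by move=> g [Gg gx]; split; [exact: GV|rewrite -{1}gx; exact: homeo_funK].
Qed.

(** Left germs, and germs at +oo, are the right germs of the reflected action. *)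
Lemma germ_group_small b (x : \bar R) (Q : groupType) :
  dyadic_model line_action b -> is_germ_group G x Q ->
  abelian_group Q /\ ~ rank_gt 1 Q.
Proof.
move=> model germ; have act_a := line_action_action.
have act_fa := flip_action act_a.
have [b1 [C1 [p1 lift1]]] := lift_exists model.
have [b2 [C2 [p2 lift2]]] := lift_exists (flip_model model).
case: x germ => [r [right|left]|top|bot].
- apply: (germ_group_of_lift (A := [set z | r < z]) act_a lift1 _ _ (stab_subgroup r) _ _ _ right).
  + by exists (r + 1); rewrite /= ltrDl.
  + by move=> y z /=; exact: lt_le_trans.
  + by move=> g [].
  + move=> g [_ gr] z /=; rewrite -{1}gr.
    by rewrite -[X in X < _]/(line_action g r) act_smono.
  + move=> g z [Gg gr] /= rz gz; split=> //; exists (z - r); rewrite ?subr_gt0 //.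
    move=> y; rewrite subrKC le_eqVlt => /andP[/predU1P[<- //|ry] yz].
    exact: gz.
- apply: (germ_group_of_lift (A := [set z | - r < z]) act_fa lift2 _ _ (stab_subgroup r) _ _ _ left).
  + by exists (- r + 1); rewrite /= ltrDl.
  + by move=> y z /=; exact: lt_le_trans.
  + by move=> g [].
  + move=> g [_ gr] z /=; rewrite -{1}gr /flip ltrN2.
    by rewrite -[X in _ < X]/(line_action g r) act_smono // ltrNl.
  + move=> g z [Gg gr] /= rz gz; split=> //; exists (z + r); first by lra.
    move=> y /andP[ry]; rewrite le_eqVlt => /predU1P[->//|yr].
    apply: oppr_inj; have := gz (- y); rewrite /flip opprK; apply; lra.
- apply: (germ_group_of_lift (A := setT) act_fa lift2 _ _ sG _ _ _ top) => //.
  + by exists 0.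
  + move=> g z Gg _ gz; split=> //; exists (- z) => y zy.
    by apply: oppr_inj; have := gz (- y) I; rewrite /flip opprK; apply; lra.
- apply: (germ_group_of_lift (A := setT) act_a lift1 _ _ sG _ _ _ bot) => //.
  + by exists 0.
  + by move=> g z Gg _ gz; split=> //; exists z => y /ltW; exact: gz.
Qed.

End Main.

Theorem corollary1p10 (R : realType) (G : set (homeo R))
  (Gsubgroup : is_subgroup G)
  (GMonod : (G `<=` MonodH R)%classic)
  (Gcoherent : coherent G)
  (Ggerms : exists (x : \bar R) (Q : groupType),
      is_germ_group G x Q /\
      ((metabelian_group Q /\ ~ abelian_group Q) \/
       (abelian_group Q /\ rank_gt 1 Q))) :
  ~ embeds G (ThompsonF R).
Proof.
move=> [phi [phiF phiM phi_inj]].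
have incr g : G g -> forall x y : R, (x < y)%R -> (g x < g y)%R.
  by move=> /GMonod[].
pose psi (g : subgroup_type Gsubgroup) := phi (subgroup_val g).
have [|||dy fb] := @thompson_dyadic R _ psi.
- by move=> g h; apply: phiM; exact: subgroup_valP.
- by move=> g; apply: phiF; exists (subgroup_val g) => //; exact: subgroup_valP.
- move=> g h gh; apply: subgroup_val_inj.
  by apply: phi_inj => //; exact: subgroup_valP.
have model := And4 (line_dynamics Gsubgroup incr Gcoherent)
  (line_noncommuting Gsubgroup incr Gcoherent) dy fb.
have [x [Q [germ bad]]] := Ggerms.
have [abQ rkQ] := germ_group_small incr model germ.
by case: bad => -[].
Qed.
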